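(* Let $(G,S)$ be a Coxeter system with $S$ finite. There exist constants $C>0$ and $\Lambda\in\mathbb{N}$ such that for every integer $n\ge 0$, every function $h\in l^2(G)$ supported on elements of length $n$, and every $f\in l^2(G)$: $$\|f\ast h\|_2\le C(n+1)^{\frac{3}{2}\Lambda}\,\|f\|_2\,\|h\|_2 .$$
   Context: The length of $g\in G$ is the word-length with respect to $S$: the least $n$ such that $g=s_1\cdots s_n$ with $s_1,\dots,s_n\in S$. Convolution is $(f\ast h)(x)=\sum_{y\in G}f(y)h(y^{-1}x)$, and $\|\cdot\|_2$ is the norm of $l^2(G)$. *)

(* Defs.v *)
From HB Require Import structures.
From mathcomp Require Import all_boot all_order all_algebra all_fingroup.
From mathcomp Require Import complex.
From mathcomp Require Import all_classical all_reals all_analysis.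

Set Implicit Arguments.
Unset Strict Implicit.
Unset Printing Implicit Defensive.

Import Order.TTheory GRing.Theory Num.Theory.
Import numFieldNormedType.Exports.

Local Open Scope classical_set_scope.
Local Open Scope ring_scope.

(* A letter [(a, true)] stands for [a], and [(a, false)] for its formal
   inverse. *)
Definition fword (A : Type) := seq (A * bool).

(* Two words are related exactly when they represent the same element of the
   group presented by the generators [A] and the relators [rel]. *)
Inductive presented_eq (A : Type) (rel : set (fword A)) :
    fword A -> fword A -> Prop :=
| presented_refl w : presented_eq rel w w
| presented_sym v w : presented_eq rel v w -> presented_eq rel w v
| presented_trans u v w :
    presented_eq rel u v -> presented_eq rel v w -> presented_eq rel u w
| presented_cancel u v a b :
    presented_eq rel (u ++ [:: (a, b); (a, ~~ b)] ++ v) (u ++ v)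
| presented_relator u v r :
    rel r -> presented_eq rel (u ++ r ++ v) (u ++ v).

Definition eval_word (G : groupType) (A : Type) (i : A -> G) (w : fword A) : G :=
  (\prod_(a <- w) (if a.2 then i a.1 else (i a.1)^-1))%g.

(* The canonical map from the presented group to [G] induced by [i] is a
   well-defined isomorphism. *)
Definition has_presentation (G : groupType) (A : Type) (i : A -> G)
    (rel : set (fword A)) : Prop :=
  (forall g, exists w, eval_word i w = g) /\
  (forall v w, eval_word i v = eval_word i w <-> presented_eq rel v w).

(* The entry [0] encodes infinity. *)
Definition coxeter_matrix (A : Type) (m : A -> A -> nat) : Prop :=
  [/\ forall s t, m s t = m t s,
      forall s, m s s = 1%N &
      forall s t, s <> t -> m s t <> 1%N].

(* The words (st)^m(s,t); for [m s t = 0] this is the empty word, which imposes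
   no relation. *)
Definition coxeter_relators (A : Type) (m : A -> A -> nat) : set (fword A) :=
  [set r | exists s t, r = flatten (nseq (m s t) [:: (s, true); (t, true)])].

Definition coxeter_system (G : groupType) (S : set G) : Prop :=
  exists m : S -> S -> nat,
    coxeter_matrix m /\
    has_presentation (fun s : S => val s) (coxeter_relators m).

Definition product_of (G : groupType) (S : set G) (g : G) (n : nat) : Prop :=
  exists w : seq G,
    [/\ size w = n, forall s, s \in w -> S s & (\prod_(s <- w) s)%g = g].

Definition has_length (G : groupType) (S : set G) (g : G) (n : nat) : Prop :=
  product_of S g n /\ forall k, product_of S g k -> (n <= k)%N.

Section L2.
Variable R : realType.

(* The l^2 norm of an arbitrary function, equal to [+oo] when the function is
   not square-summable. *)
Definition l2norm (T : choiceType) (f : T -> R[i]) : \bar R :=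
  sqrte (\esum_(x in [set: T]) (Normc.normc (f x) ^+ 2)%:E).

Definition l2 (T : choiceType) : set (T -> R[i]) :=
  [set f | (l2norm f < +oo)%E].

(* Unordered sum of a real, resp. complex, family. It has its usual meaning
   for absolutely summable families; otherwise [fine] makes it a junk value. *)
Definition real_sum (T : choiceType) (a : T -> R) : R :=
  fine (\esum_(x in [set: T]) (Num.max (a x) 0)%:E) -
  fine (\esum_(x in [set: T]) (Num.max (- a x) 0)%:E).

Definition complex_sum (T : choiceType) (a : T -> R[i]) : R[i] :=
  Complex (real_sum (fun x => complex.Re (a x)))
          (real_sum (fun x => complex.Im (a x))).

(* For [f] and [h] in l^2(G) the family summed here is absolutely summable, by
   the Cauchy-Schwarz inequality. *)
Definition convolution (G : groupType) (f h : G -> R[i]) : G -> R[i] :=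
  fun x => complex_sum (fun y => f y * h (y^-1 * x)%g).

End L2.

(* Main.v *)
Require Import Defs.
From mathcomp Require Import all_boot all_order all_algebra all_fingroup.
From mathcomp Require Import complex finmap.
From mathcomp Require Import all_classical all_reals all_analysis.
From mathcomp Require Import ring lra zify.

(** Rapid decay for finitely generated Coxeter groups, by taking medians of
    triangles in the system of walls.

    The group acts on its root system.  A wall is a positive root, and
    [inversions g], the finite set of walls that separate 1 from [g], has
    [word_len g] elements.  The walls that separate 1 both from [y] and from
    [x] form the finite set [median y x]; it encodes the median of 1, [y], [x]
    in the cube complex dual to the walls, a point which is in general not a
    group element.

    The terms of the sum over [y] of [f y * h (y^-1 * x)] are grouped
    according to [median y x], and Cauchy-Schwarz is applied twice
    ([labelled_schur]).  What remains are three counts: the medians possible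
    for a given [x]; the medians possible for a given [y]; the [y] possible
    for a given median and a given [y^-1 * x].  All three are bounded by a
    constant times [(n + 1) ^ Lambda], where [Lambda] is the number of colours
    introduced below; the square root of their product is the bound claimed.

    The counts rest on a colouring of the walls by finitely many colours such
    that distinct walls of the same colour never cross: all four intersections
    of their half-spaces cannot be nonempty ([four_quadrants]).  The walls of
    one colour that separate two elements are then linearly ordered, a third
    element cuts off an initial segment of them, and such a segment is known
    from its cardinality ([common_determined]).  A set of at most [n] walls
    which is cut off in this way is thus one of at most [(n + 1) ^ Lambda].

    The colour of a wall is its reflection modulo 3.  The matrices of the
    geometric representation have entries in an order of a real number field,
    namely the ring generated by [2 cos (pi / N)], so that there are finitely
    many colours.  By an argument of Minkowski, a matrix congruent to 1 modulo
    3 some positive power of which fixes a vector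
    fixes this vector itself ([minkowski]).  If two walls [a], [b] cross, then every
    root [a (r_a r_b)^k] or its opposite separates two of the four given
    elements; hence the orbit of [a] is finite, [r_a r_b] fixes [a] when the
    colours agree, and [a = b].  Likewise the stabiliser of a median is a
    torsion group and so meets the congruence subgroup trivially; this bounds
    the third count ([median_stabiliser]).

    The root system enters only through the dichotomy between positive and
    negative roots, proved as in Tits: [simple_rho_ge0].

    Vectors are rows and the group acts from the right.  So [b *m rho g] is
    what is classically written as the image of [b] under the inverse of [g],
    and [g] inverts [b] if [b] is positive and [b *m rho g] negative. *)

Set Implicit Arguments.
Unset Strict Implicit.
Unset Printing Implicit Defensive.

Import Order.TTheory GRing.Theory Num.Theory.

Local Open Scope classical_set_scope.
Local Open Scope ring_scope.

(** * Orders in a number field and divisibility by 3 *)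

Section IntegralOrder.
Context (R : numFieldType) (d : nat) (gen : 'I_d -> R).

Definition zspan (x : R) : Prop :=
  exists k : 'I_d -> int, x = \sum_j (k j)%:~R * gen j.

Definition is_order : Prop :=
  zspan 1 /\ forall i j, zspan (gen i * gen j).

Lemma zspan0 : zspan 0.
Proof. by exists (fun=> 0); rewrite big1 // => j _; rewrite mul0r. Qed.

Lemma zspanD x y : zspan x -> zspan y -> zspan (x + y).
Proof.
move=> [k ->] [l ->]; exists (fun j => k j + l j).
by rewrite -big_split; apply: eq_bigr => j _; rewrite intrD mulrDl.
Qed.

Lemma zspanZ (z : int) x : zspan x -> zspan (z%:~R * x).
Proof.
move=> [k ->]; exists (fun j => z * k j).
by rewrite mulr_sumr; apply: eq_bigr => j _; rewrite intrM mulrA.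
Qed.

Lemma zspanN x : zspan x -> zspan (- x).
Proof. by move=> /(zspanZ (-1)); rewrite mulrN1z mulN1r. Qed.

Lemma zspan_sum (I : Type) (r : seq I) (P : pred I) (F : I -> R) :
  (forall i, P i -> zspan (F i)) -> zspan (\sum_(i <- r | P i) F i).
Proof. exact: (big_ind zspan zspan0 zspanD). Qed.

Lemma zspan_gen j : zspan (gen j).
Proof.
exists (fun i => (i == j)%:R); rewrite (bigD1 j) //= eqxx mul1r big1 ?addr0 //.
by move=> i /negbTE ->; rewrite mul0r.
Qed.

Hypothesis Aord : is_order.

Lemma zspan_int z : zspan z%:~R.
Proof. by rewrite -[_%:~R]mulr1; apply: zspanZ; case: Aord. Qed.

Lemma zspanM x y : zspan x -> zspan y -> zspan (x * y).
Proof.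
move=> [k ->] [l ->]; rewrite mulr_suml; apply: zspan_sum => i _.
rewrite mulr_sumr; apply: zspan_sum => j _.
rewrite mulrACA -intrM; apply: zspanZ; exact: Aord.2.
Qed.

(** The determinant trick: multiplication by [x] maps the generators to integer
    combinations of generators, so [x] is an eigenvalue of an integer matrix. *)
Lemma zspan_integral x : zspan x ->
  exists2 p : {poly int}, p \is monic & root (map_poly intr p) x.
Proof.
move=> Ax.
have : forall i, exists k : 'I_d -> int, x * gen i = \sum_j (k j)%:~R * gen j.
  by move=> i; apply: zspanM => //; apply: zspan_gen.
move=> /fin_all_exists [k kE].
pose X : 'M[int]_d := \matrix_(i, j) k j i.
exists (char_poly X); first exact: char_poly_monic.
rewrite map_char_poly -eigenvalue_root_char; apply/eigenvalueP.
exists (\row_j gen j).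
  apply/rowP => i; rewrite !mxE kE; apply: eq_bigr => j _.
  by rewrite !mxE mulrC.
apply/eqP => gen0; case: Aord.1 => l E1; have /eqP := oner_neq0 R; apply.
rewrite E1 big1 // => j _.
by move/rowP: gen0 => /(_ j); rewrite !mxE => ->; rewrite mulr0.
Qed.

(** The quotient [z / 3] is rational and integral over Z, hence an integer; with
    a denominator which is the prime 3 the rational root test only needs
    Euclid's lemma. *)
Lemma zspan_dvd3 (z : int) b : zspan b -> z%:~R = 3 * b -> (3 %| z)%Z.
Proof.
move=> /zspan_integral [p pmon /rootP pb] zb.
pose m := (size p).-1.
have sz : size p = m.+1 by rewrite prednK // size_poly_gt0 monic_neq0.
have bE : b = z%:~R / 3 by rewrite zb mulrC mulKf // pnatr_eq0.
have E : z ^+ m + 3 * \sum_(i < m) p`_i * z ^+ i * 3 ^+ (m - i).-1 = 0.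
  apply/(@intr_inj R); rewrite rmorph0 rmorphD rmorphM rmorphXn.
  have -> : (0 : R) = 3 ^+ m * (map_poly intr p).[b] by rewrite pb mulr0.
  rewrite horner_coef size_map_inj_poly ?rmorph0 //; last exact: intr_inj.
  rewrite sz big_ord_recr /= mulrDr addrC; congr (_ + _).
    rewrite rmorph_sum /= !mulr_sumr; apply: eq_bigr => i _.
    rewrite coef_map /= !rmorphM !rmorphXn /= bE expr_div_n.
    have -> : (3 : R) ^+ m = 3 * 3 ^+ (m - i).-1 * 3 ^+ i.
      rewrite -exprS -exprD prednK ?subn_gt0 //; congr (_ ^+ _).
      by rewrite subnK // ltnW.
    have h : (3 : R) ^+ i != 0 by rewrite expf_neq0 // pnatr_eq0.
    by field.
  rewrite coef_map /=; have /monicP := pmon; rewrite lead_coefE -/m => ->.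
  rewrite mul1r bE expr_div_n mulrCA mulfV ?mulr1 // expf_neq0 // pnatr_eq0 //.
have : (3 %| z ^+ m)%Z.
  by rewrite -(opprK (z ^+ m)) (addr0_eq E) dvdzE abszN -dvdzE dvdz_mulr.
by rewrite !dvdzE abszX Euclid_dvdX // => /andP[].
Qed.

(** The constant coefficient of an integral equation of [x], after division by a
    power of the variable, is a multiple of [x]: a substitute for the norm. *)
Lemma zspan_norm x : zspan x -> x != 0 ->
  exists y (z : int), [/\ zspan y, z != 0 & x * y = z%:~R].
Proof.
move=> Ax x0; have [p pmon] := zspan_integral Ax.
have p0 : p != 0 by rewrite monic_neq0.
elim/poly_ind: p p0 {pmon} => [|p c IH p0 /rootP]; first by rewrite eqxx.
rewrite rmorphD rmorphM /= map_polyX map_polyC /= hornerMXaddC.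
have [c0|c0] := eqVneq c 0.
  rewrite c0 addr0 => /eqP; rewrite mulf_eq0 (negbTE x0) orbF => px.
  by apply: IH px; apply: contraNneq p0 => ->; rewrite c0 mul0r add0r.
move=> E; exists (- (map_poly intr p).[x]), c; split=> //.
  apply: zspanN; rewrite horner_poly; apply: zspan_sum => i _.
  apply: zspanM; first exact: zspan_int.
  elim: {i}(i : nat) => [|i IHi]; first by rewrite expr0; case: Aord.
  by rewrite exprS; apply: zspanM.
by rewrite mulrN mulrC; apply: addr0_eq E.
Qed.

(** The 3-adic topology of the order is separated, since the one of Z is: by
    [zspan_norm] some multiple of [x] is an integer. *)
Lemma zspan_separated x : zspan x ->
  (forall k, exists2 b, zspan b & x = 3 ^+ k * b) -> x = 0.
Proof.
move=> Ax x3; apply/eqP/negPn/negP => x0.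
have [y [z [Ay z0 xy]]] := zspan_norm Ax x0.
have {}x3 k : exists2 b, zspan b & z%:~R = 3 ^+ k * b.
  have [b Ab xb] := x3 k; exists (b * y); first exact: zspanM.
  by rewrite -xy xb mulrA.
have dvd k : (3 ^+ k %| z)%Z.
  elim: k => [|k /dvdzP[q zq]]; first by rewrite expr0 dvd1z.
  have [b Ab zb] := x3 k.+1.
  have /(zspan_dvd3 Ab) /dvdzP[r qr]: q%:~R = 3 * b.
    have h : (3 : R) ^+ k != 0 by rewrite expf_neq0 // pnatr_eq0.
    apply: (mulIf h); rewrite -mulrA (mulrC b) mulrA -exprS -zb zq.
    by rewrite rmorphM rmorphXn.
  by apply/dvdzP; exists r; rewrite zq qr exprS mulrA.
have := dvdn_leq _ (dvd `|z|%N); rewrite absz_gt0 z0 => /(_ isT).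
by rewrite abszX leqNgt ltn_expl.
Qed.

End IntegralOrder.

(** * Minkowski: matrices congruent to 1 modulo 3 *)

Section Minkowski.
Context (R : numFieldType) (d : nat) (gen : 'I_d -> R).
Hypothesis Aord : is_order gen.
Local Notation A := (zspan gen).

Definition zspan_mx m n (X : 'M[R]_(m, n)) : Prop := forall i j, A (X i j).

Lemma zspan_mxD m n (X Y : 'M[R]_(m, n)) :
  zspan_mx X -> zspan_mx Y -> zspan_mx (X + Y).
Proof. by move=> AX AY i j; rewrite mxE; apply: zspanD. Qed.

Lemma zspan_mxN m n (X : 'M[R]_(m, n)) : zspan_mx X -> zspan_mx (- X).
Proof. by move=> AX i j; rewrite mxE; apply: zspanN. Qed.

Lemma zspan_mxM m n p (X : 'M[R]_(m, n)) (Y : 'M[R]_(n, p)) :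
  zspan_mx X -> zspan_mx Y -> zspan_mx (X *m Y).
Proof.
by move=> AX AY i j; rewrite mxE; apply: zspan_sum => k _; apply: zspanM.
Qed.

Lemma zspan_mxZ m n (z : int) (X : 'M[R]_(m, n)) :
  zspan_mx X -> zspan_mx (z%:~R *: X).
Proof. by move=> AX i j; rewrite mxE; apply: zspanZ. Qed.

Lemma zspan_mx1 n : zspan_mx (1%:M : 'M[R]_n).
Proof.
by move=> i j; rewrite mxE; case: (i == j); [case: Aord|apply: zspan0].
Qed.

Lemma zspan_mx_sum m n (I : Type) (r : seq I) (F : I -> 'M[R]_(m, n)) :
  (forall i, zspan_mx (F i)) -> zspan_mx (\sum_(i <- r) F i).
Proof.
move=> AF; apply: (big_ind (@zspan_mx m n)) => //; last exact: zspan_mxD.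
by move=> i j; rewrite mxE; apply: zspan0.
Qed.

Definition cong3 m n (X Y : 'M[R]_(m, n)) : Prop :=
  exists2 B, zspan_mx B & X = Y + 3 *: B.

Lemma cong3_mulr m n p (X Y : 'M[R]_(m, n)) (Z : 'M[R]_(n, p)) :
  zspan_mx Z -> cong3 X Y -> cong3 (X *m Z) (Y *m Z).
Proof.
move=> AZ [B AB ->]; exists (B *m Z); first exact: zspan_mxM.
by rewrite mulmxDl -scalemxAl.
Qed.

Lemma cong3_exp n (X : 'M[R]_n) k : cong3 X 1%:M -> cong3 (X ^+ k) 1%:M.
Proof.
move=> [B AB XE]; elim: k => [|k [C AC XkE]].
  by exists 0; rewrite ?scaler0 ?addr0 ?expr0 // => i j; rewrite mxE; apply: zspan0.
exists (B + C + 3 *: (B *m C)).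
  have : zspan_mx ((3 : int)%:~R *: (B *m C)) by apply/zspan_mxZ/zspan_mxM.
  by move=> ABC; apply: zspan_mxD => //; apply: zspan_mxD.
rewrite exprS XkE {1}XE -[_ * _]/(_ *m _).
rewrite mulmxDl !mulmxDr !mul1mx mulmx1 -scalemxAl -scalemxAr !scalerDr.
by rewrite -!addrA; congr (_ + _); rewrite addrCA.
Qed.

(** Put [u = v X - v].  Then [u (1 + X + ... + X^(p-1)) = 0], while the sum of
    powers is [p] modulo 3, and it is 3 times a matrix congruent to 1 if
    [p = 3].  In both cases [u = 3 u C] for an integral matrix [C]; on iterating,
    [u] is divisible by all powers of 3, and so it vanishes. *)
Lemma minkowski_prime n (X : 'M[R]_n) (v : 'rV[R]_n) p : prime p ->
  cong3 X 1%:M -> zspan_mx v -> v *m X ^+ p = v -> v *m X = v.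
Proof.
move=> p_pr X1 Av vXp.
have [C [AC CP]] : exists C : 'M[R]_n, zspan_mx C /\
    forall u : 'rV[R]_n, u *m (\sum_(i < p) X ^+ i) = 0 -> u = 3 *: (u *m C).
  have [p3|pn3] := eqVneq p 3.
    have [B AB XE] := X1.
    (* Here [1 + X + X^2 = 3 (1 + 3 (B + B^2))] for [X = 1 + 3 B]. *)
    exists (- (B + B *m B)); split.
      by apply/zspan_mxN/zspan_mxD => //; apply: zspan_mxM.
    move=> u; rewrite p3 !big_ord_recl big_ord0 /= expr0 expr1 expr2.
    rewrite XE -[_ * _]/(_ *m _) => u0.
    have h3 : (3 : R) != 0 by rewrite pnatr_eq0.
    apply: (scalerI h3); apply/eqP; rewrite -subr_eq0 -[X in _ == X]u0; apply/eqP.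
    rewrite addr0 -[X in u *m (X + _)]/(1%:M) !mulmxDl !mulmxDr !mul1mx !mulmx1.
    rewrite -?scalemxAr -?scalemxAl -?scalemxAr mulmxN mulmxDr.
    by apply/rowP => i; rewrite !mxE; ring.
  have /fin_all_exists2[B AB XE] : forall i : 'I_p,
      exists2 B, zspan_mx B & X ^+ i = 1%:M + 3 *: B.
    by move=> i; apply: cong3_exp.
  have [a [b ab]] : exists a b : int, (1 : int) = a * p + 3 * b.
    have : coprimez p 3 by rewrite coprimezE /= prime_coprime // dvdn_prime2.
    move=> /coprimezP[[a b] /= ab]; exists a, b.
    rewrite -ab; lia.
  exists (b%:~R *: 1%:M - a%:~R *: \sum_i B i); split.
    apply: zspan_mxD; first by apply/zspan_mxZ/zspan_mx1.
    by apply/zspan_mxN/zspan_mxZ/zspan_mx_sum.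
  move=> u; rewrite (eq_bigr _ (fun i _ => XE i)) big_split /= sumr_const card_ord.
  rewrite -scaler_sumr mulmxDr -scaler_nat -!scalemxAr mulmx1 => u0.
  rewrite mulmxBr -!scalemxAr mulmx1 scalerBr !scalerA.
  have : a%:~R *: (p%:R *: u + 3 *: (u *m (\sum_i B i))) = 0 by rewrite u0 scaler0.
  rewrite scalerDr !scalerA => /addr0_eq; rewrite (mulrC 3 a%:~R) => <-.
  rewrite opprK -scalerDl -[LHS]scale1r; congr (_ *: _).
  move/(congr1 (fun z : int => z%:~R : R)): ab.
  rewrite intrD !intrM -[1%:~R]/(1 : R) -[3%:~R]/(3 : R) -[(p : int)%:~R]/(p%:R : R).
  by move=> E; rewrite [LHS]E; ring.
apply/eqP; rewrite -subr_eq0; apply/eqP; apply/rowP => i; rewrite [RHS]mxE.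
pose u := v *m X - v.
have AX : zspan_mx X.
  case: X1 => B AB ->; apply: zspan_mxD; first exact: zspan_mx1.
  exact: (@zspan_mxZ _ _ 3).
have Au : zspan_mx u by apply/zspan_mxD; [apply: zspan_mxM|apply: zspan_mxN].
have u0 : u *m (\sum_(i < p) X ^+ i) = 0.
  have -> : u = v *m (X - 1) by rewrite mulmxBr mulmx1.
  by rewrite -mulmxA -[(_ - _) *m _]/(_ * _) -subrX1 mulmxBr mulmx1 vXp subrr.
have uC := CP _ u0.
have uk k : exists2 w, zspan_mx w & u = 3 ^+ k *: w.
  suff uk : u = 3 ^+ k *: (u *m C ^+ k).
    exists (u *m C ^+ k) => //; apply: zspan_mxM => //.
    elim: k {uk} => [|k IH]; first exact: zspan_mx1.
    by rewrite exprS; apply: zspan_mxM.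
  elim: k => [|k IH]; first by rewrite scale1r mulmx1.
  rewrite {1}IH {1}uC -scalemxAl scalerA -mulmxA -exprSr.
  by rewrite -[C *m _]/(C * _) -exprS.
apply: (zspan_separated Aord); first exact: Au.
move=> k; have [w Aw uw] := uk k; exists (w 0 i) => //.
by rewrite -/u uw mxE.
Qed.

Lemma minkowski n (X : 'M[R]_n) (v : 'rV[R]_n) k : (0 < k)%N ->
  cong3 X 1%:M -> zspan_mx v -> v *m X ^+ k = v -> v *m X = v.
Proof.
move=> + X1 Av; elim/ltn_ind: k => k IH k0 vXk.
have [k1|k1] := leqP k 1.
  by have k1' : k = 1%N; [lia|rewrite k1' expr1 in vXk].
have p_pr := pdiv_prime k1.
have /dvdnP[q kE] := pdiv_dvd k.
have q0 : (0 < q)%N by case: q kE => //; lia.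
apply: (IH q) => //; first by rewrite kE ltn_Pmulr // prime_gt1.
apply: (minkowski_prime p_pr) => //; first exact: cong3_exp.
by rewrite -exprM -kE.
Qed.

(** The order is finitely generated, so its quotient by 3 is finite.  The label
    of an entry lists residues of coordinates with respect to generators
    which need not be independent: coordinates are chosen once for each entry,
    and equal labels imply congruence, but not conversely. *)
Lemma cong3_label m n : exists (Q : finType) (lab : 'M[R]_(m, n) -> Q),
  forall X Y, zspan_mx X -> zspan_mx Y -> lab X = lab Y -> cong3 X Y.
Proof.
have : forall x : R, exists k : 'I_d -> int, A x -> x = \sum_j (k j)%:~R * gen j.
  move=> x; case: (pselect (A x)) => [[k kE]|nA]; first by exists k.
  by exists (fun=> 0).
move=> /choice[k kE].
exists 'M[{ffun 'I_d -> 'I_3}]_(m, n).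
exists (fun X => \matrix_(i, j) [ffun l => inord `|(k (X i j) l %% 3)%Z|]).
move=> X Y AX AY XY.
have {}XY i j l : (3 %| k (X i j) l - k (Y i j) l)%Z.
  have /matrixP/(_ i j) := XY; rewrite !mxE => /ffunP/(_ l).
  rewrite !ffunE => /(congr1 val); rewrite /= !inordK; last 2 first.
  - by rewrite -ltz_nat gez0_abs ?modz_ge0 // ltz_pmod.
  - by rewrite -ltz_nat gez0_abs ?modz_ge0 // ltz_pmod.
  move=> E; rewrite -eqz_mod_dvd; apply/eqP.
  by rewrite -[LHS]gez0_abs ?modz_ge0 // E gez0_abs ?modz_ge0.
exists (\matrix_(i, j) \sum_l ((k (X i j) l - k (Y i j) l) %/ 3)%Z%:~R * gen l).
  by move=> i j; rewrite mxE; exists (fun l => ((k (X i j) l - k (Y i j) l) %/ 3)%Z).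
apply/matrixP => i j; rewrite !mxE {1}(kE _ (AX i j)) {1}(kE _ (AY i j)).
rewrite mulr_sumr -big_split; apply: eq_bigr => l _ /=.
rewrite mulrA -mulrDl; congr (_ * _).
have /dvdzP[q qE] := XY i j l.
rewrite qE mulzK // mulrC -[3 : R]/((3 : int)%:~R) -intrM -intrD -qE.
by congr _%:~R; rewrite addrC subrK.
Qed.
End Minkowski.

(** * The order of double cosines and the geometric representation *)

Section CosineOrder.
Context (R : realType) (N : nat).
Hypothesis N0 : (0 < N)%N.

Definition cos2 (k : nat) : R := 2 * cos (k%:R * (pi / N%:R)).

(** The generator of index 0 is 1 instead of [cos2 0 = 2], in order that the span
    contains 1. *)
Definition cos_gen (j : 'I_N.*2) : R := if j == 0%N :> nat then 1 else cos2 j.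

Lemma cos2_mod k : cos2 k = cos2 (k %% N.*2)%N.
Proof.
rewrite /cos2 {1}(divn_eq k N.*2); elim: (k %/ N.*2)%N => // q <-.
congr (_ * _); rewrite -[RHS]cosD2pi; congr (cos _).
rewrite mulSn -addnA addnC natrD mulrDl; congr (_ + _).
have : N%:R != 0 :> R by rewrite pnatr_eq0; lia.
by rewrite -addnn natrD => ?; field.
Qed.

Lemma zspan_cos2 k : zspan cos_gen (cos2 k).
Proof.
have lt : (k %% N.*2 < N.*2)%N by rewrite ltn_mod double_gt0.
have := zspan_gen cos_gen (Ordinal lt).
rewrite cos2_mod /cos_gen /=; case: eqP => // -> A1.
rewrite /cos2 mul0r cos0 mulr1 -[2]/(1 + 1).
exact: zspanD.
Qed.

Lemma cos2M i j : (i <= j)%N -> cos2 i * cos2 j = cos2 (j + i) + cos2 (j - i).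
Proof.
move=> ij; rewrite /cos2 natrD natrB //; set x := pi / _.
by rewrite (mulrBl x) (mulrDl _ _ x) cosB cosD; ring.
Qed.

(** Products of generators remain in the span by the product formula for
    cosines and by periodicity. *)
Lemma cos_order : is_order cos_gen.
Proof.
have one : zspan cos_gen 1.
  have lt : (0 < N.*2)%N by rewrite double_gt0.
  by have := zspan_gen cos_gen (Ordinal lt); rewrite /cos_gen.
split=> //.
move=> i j; rewrite {2 3}/cos_gen; case: eqP => _; case: eqP => _.
- by rewrite mulr1; exact: one.
- by rewrite mul1r; apply: zspan_cos2.
- by rewrite mulr1; apply: zspan_cos2.
case: (leqP i j) => [ij|/ltnW ij]; last rewrite mulrC.
  by rewrite cos2M //; apply: zspanD; apply: zspan_cos2.
by rewrite cos2M //; apply: zspanD; apply: zspan_cos2.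
Qed.
End CosineOrder.

Section Chebyshev.
Context (R : realType).

(** Chebyshev polynomials of the second kind in the variable [c / 2], with the
    index shifted by one. *)
Fixpoint chebU (c : R) (k : nat) : R :=
  match k with
  | 0 => 0
  | k'.+1 => if k' is k''.+1 then c * chebU c k' - chebU c k'' else 1
  end.

Lemma chebU0 c : chebU c 0 = 0. Proof. by []. Qed.

Lemma chebU1 c : chebU c 1 = 1. Proof. by []. Qed.

Lemma chebUSS c k : chebU c k.+2 = c * chebU c k.+1 - chebU c k.
Proof. by []. Qed.

Lemma chebU_sin (t : R) k :
  sin t * chebU (2 * cos t) k = sin (k%:R * t).
Proof.
suff : sin t * chebU (2 * cos t) k = sin (k%:R * t) /\
   sin t * chebU (2 * cos t) k.+1 = sin (k.+1%:R * t) by case.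
elim: k => [|k [IH0 IH1]]; first by rewrite mul0r sin0 mulr0 mul1r mulr1.
split=> //; rewrite chebUSS mulrBr mulrCA IH0 IH1.
have -> : k%:R * t = k.+1%:R * t - t by rewrite -natr1; ring.
have -> : k.+2%:R * t = k.+1%:R * t + t by rewrite -(natr1 k.+1); ring.
by rewrite sinB sinD; ring.
Qed.

Lemma chebU2 k : chebU 2 k = k%:R.
Proof.
suff : chebU 2 k = k%:R /\ chebU 2 k.+1 = k.+1%:R by case.
elim: k => [|k [IH0 IH1]] //; split=> //; rewrite chebUSS IH0 IH1.
by rewrite -!natr1; ring.
Qed.
End Chebyshev.
Arguments chebU : simpl never.

Section Geometric.
Context (R : realType) (n : nat) (m : 'I_n -> 'I_n -> nat).
Hypothesis m_sym : forall i j, m i j = m j i.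
Hypothesis m_diag : forall i, m i i = 1%N.
Hypothesis m_off : forall i j, i <> j -> m i j <> 1%N.

(** The label 0 stands for an infinite product order and gives a pair of simple
    roots which span a degenerate plane. *)
Definition cox_cos (i j : 'I_n) : R :=
  if m i j == 0%N then 2 else 2 * cos (pi / (m i j)%:R).

Definition cartan : 'M[R]_n := \matrix_(i, j) - cox_cos i j.

Definition cox_form (u v : 'rV[R]_n) : R := (u *m cartan *m v^T) 0 0.

(** The matrix of [v |-> v - form v u *: u], a reflection when [u] has norm 2. *)
Definition reflection (u : 'rV[R]_n) : 'M[R]_n := 1 - cartan *m u^T *m u.

Definition simple_root (i : 'I_n) : 'rV[R]_n := delta_mx 0 i.

Lemma formDl u v w : cox_form (u + v) w = cox_form u w + cox_form v w.
Proof. by rewrite /cox_form !mulmxDl mxE. Qed.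

Lemma formZl a u w : cox_form (a *: u) w = a * cox_form u w.
Proof. by rewrite /cox_form -!scalemxAl mxE. Qed.

Lemma form_sym u v : cox_form u v = cox_form v u.
Proof.
rewrite /cox_form -[LHS]/(_ 0 0) -[in LHS](trmxK (_ *m _)) mxE !trmx_mul trmxK mulmxA.
congr ((_ *m _ *m _) 0 0); apply/matrixP => i j.
by rewrite !mxE /cox_cos m_sym.
Qed.

Lemma formNl u w : cox_form (- u) w = - cox_form u w.
Proof. by rewrite -scaleN1r formZl mulN1r. Qed.

Lemma formBl u v w : cox_form (u - v) w = cox_form u w - cox_form v w.
Proof. by rewrite formDl formNl. Qed.

Lemma formBr u v w : cox_form w (u - v) = cox_form w u - cox_form w v.
Proof. by rewrite form_sym formBl !(form_sym w). Qed.

Lemma formZr a u w : cox_form w (a *: u) = a * cox_form w u.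
Proof. by rewrite form_sym formZl form_sym. Qed.

Lemma form_simple i j : cox_form (simple_root i) (simple_root j) = - cox_cos i j.
Proof.
rewrite /cox_form /simple_root -rowE trmx_delta -colE !mxE.
by [].
Qed.

Lemma cox_cosii i : cox_cos i i = -2.
Proof. by rewrite /cox_cos m_diag /= divr1 cospi mulrN1. Qed.

Lemma form_simplei i : cox_form (simple_root i) (simple_root i) = 2.
Proof. by rewrite form_simple cox_cosii opprK. Qed.

Lemma mul_refl v u : v *m reflection u = v - cox_form v u *: u.
Proof.
rewrite /reflection mulmxBr mulmx1 !mulmxA; congr (_ - _).
by rewrite -mul_scalar_mx /cox_form -mx11_scalar.
Qed.

Lemma refl_form u v w : cox_form u u = 2 ->
  cox_form (v *m reflection u) (w *m reflection u) = cox_form v w.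
Proof.
move=> uu; rewrite !mul_refl !formBl !formBr !formZl !formZr uu.
by rewrite (form_sym u w); ring.
Qed.

Lemma refl_self u : cox_form u u = 2 -> u *m reflection u = - u.
Proof. by move=> uu; rewrite mul_refl uu scalerDl scale1r opprD addNKr. Qed.

Lemma row_mx_eq (X Y : 'M[R]_n) : (forall v : 'rV_n, v *m X = v *m Y) -> X = Y.
Proof. by move=> XY; apply/row_matrixP => i; rewrite !rowE XY. Qed.

Lemma refl_sq u : cox_form u u = 2 -> reflection u *m reflection u = 1%:M.
Proof.
move=> uu; apply: row_mx_eq => v; rewrite mulmxA mulmx1 !mul_refl.
rewrite formBl formZl uu.
by apply/rowP => i; rewrite !mxE; ring.
Qed.

Definition isometry (X : 'M[R]_n) := forall v w, cox_form (v *m X) (w *m X) = cox_form v w.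

Lemma refl_conj (X Y : 'M[R]_n) u : isometry X -> Y *m X = 1%:M ->
  Y *m reflection u *m X = reflection (u *m X).
Proof.
move=> isoX YX; apply: row_mx_eq => v; rewrite !mulmxA !mul_refl mulmxBl.
by rewrite -!scalemxAl -mulmxA YX mulmx1 -(isoX (v *m Y)) -mulmxA YX mulmx1.
Qed.

Lemma cox_cos_lt i j : i <> j -> m i j <> 0%N -> cox_cos i j ^+ 2 != 4.
Proof.
move=> ij /eqP/negbTE m0; rewrite /cox_cos m0.
have mgt : (1 < m i j)%N by move/m_off: ij; move/eqP: m0; lia.
have : 0 < sin (pi / (m i j)%:R : R).
  apply: sin_gt0_pi; rewrite divr_gt0 ?pi_gt0 ?ltr0n //=; last lia.
  rewrite ltr_pdivrMr ?ltr0n; last lia.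
  by rewrite -[X in X < _]mulr1 ltr_pM2l ?pi_gt0 // ltr1n.
move=> s0; apply/eqP => E.
have := sin2cos2 (pi / (m i j)%:R : R); nra.
Qed.

Fixpoint alt_mx (i j : 'I_n) (k : nat) : 'M[R]_n :=
  if k is k'.+1 then reflection (simple_root i) *m alt_mx j i k' else 1%:M.

Lemma cox_cosC i j : cox_cos i j = cox_cos j i.
Proof. by rewrite /cox_cos m_sym. Qed.

Lemma simple_refl i j :
  simple_root j *m reflection (simple_root i) = simple_root j + cox_cos i j *: simple_root i.
Proof. by rewrite mul_refl form_simple scaleNr opprK cox_cosC. Qed.

(** Applied to a simple root, the first letter of an alternating word gives a
    combination of the two simple roots; shorter alternating words act on both
    of them, and the recursion obtained is that of [chebU]. *)
Lemma simple_alt_mx i j k :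
  simple_root j *m alt_mx i j k =
  let U := chebU (cox_cos i j) in
  if odd k then U k *: simple_root j + U k.+1 *: simple_root i
  else U k.+1 *: simple_root j + U k *: simple_root i.
Proof.
elim/ltn_ind: k i j => k IH i j; case: k IH => [|[|k]] IH.
- by rewrite mulmx1 /= scale1r scale0r addr0.
- by rewrite /= mulmx1 simple_refl scale1r chebUSS chebU1 chebU0 mulr1 subr0.
rewrite [alt_mx _ _ _]/= mulmxA simple_refl mulmxDl -scalemxAl.
rewrite mulmxA refl_self ?form_simplei // mulNmx IH // -/(alt_mx j i k.+1) IH //.
rewrite (cox_cosC j i) /= negbK !chebUSS.
by case: (odd k) => /=; apply/rowP => l; rewrite !mxE; ring.
Qed.

(** For a finite label, [chebU] at [k] is [sin (k t) / sin t] with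
    [t = pi / m i j], and [k t] lies in the interval from 0 to [pi]. *)
Lemma chebU_ge0 i j k : i <> j -> m i j = 0%N \/ (k <= m i j)%N ->
  0 <= chebU (cox_cos i j) k.
Proof.
move=> ij km; rewrite /cox_cos; case: eqVneq => [_|m0]; first by rewrite chebU2.
have {}km : (k <= m i j)%N by case: km => // /eqP; rewrite (negbTE m0).
have mgt : (1 < m i j)%N by move/m_off: ij; move/eqP: m0; lia.
have mR : 0 < (m i j)%:R :> R by rewrite ltr0n; lia.
have s0 : 0 < sin (pi / (m i j)%:R : R).
  apply: sin_gt0_pi; rewrite divr_gt0 ?pi_gt0 //= ltr_pdivrMr //.
  by rewrite -[X in X < _]mulr1 ltr_pM2l ?pi_gt0 // ltr1n.
rewrite -(pmulr_rge0 _ s0) chebU_sin; apply: sin_ge0_pi.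
rewrite mulr_ge0 ?divr_ge0 ?pi_ge0 //= mulrCA -[X in _ <= X]mulr1.
by rewrite ler_pM2l ?pi_gt0 // ler_pdivrMr // mul1r ler_nat.
Qed.

Lemma simple_alt_mx_ge0 i j k : i <> j -> m i j = 0%N \/ (k < m i j)%N ->
  exists p q : R, [/\ 0 <= p, 0 <= q &
    simple_root j *m alt_mx i j k = p *: simple_root j + q *: simple_root i].
Proof.
move=> ij km; have km' : m i j = 0%N \/ (k <= m i j)%N.
  by case: km; [left|right; apply: ltnW].
rewrite simple_alt_mx /=; case: (odd k); do 2 eexists; split; try reflexivity;
  by apply: chebU_ge0.
Qed.

Lemma alt_mx_exp i j k :
  (reflection (simple_root i) *m reflection (simple_root j)) ^+ k = alt_mx i j k.*2.
Proof.
elim: k => [|k IH]; first by rewrite expr0.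
by rewrite exprS IH -[_ * _]/(_ *m _) /= -mulmxA.
Qed.

(** The product of the two reflections rotates the plane by [2 pi / m i j]: at the
    index [2 * m i j] of a full turn, [simple_alt_mx] has coefficients 0 and 1. *)
Lemma plane_fixed i j (k := m i j) (p q : R) : i <> j -> k <> 0%N ->
  (p *: simple_root j + q *: simple_root i) *m alt_mx i j k.*2 =
  p *: simple_root j + q *: simple_root i.
Proof.
move=> ij k0; have kgt : (1 < k)%N by move/m_off: ij; rewrite /k in k0 *; lia.
have k2gt : (0 < k.*2)%N by rewrite double_gt0 ltnW.
have kR : 0 < k%:R :> R by rewrite ltr0n; lia.
have s0 : 0 < sin (pi / k%:R : R).
  apply: sin_gt0_pi; rewrite divr_gt0 ?pi_gt0 //= ltr_pdivrMr //.
  by rewrite -[X in X < _]mulr1 ltr_pM2l ?pi_gt0 // ltr1n.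
have cE : cox_cos i j = 2 * cos (pi / k%:R).
  by rewrite /cox_cos -/k; case: eqP k0.
have kpi : k.*2%:R * (pi / k%:R) = pi *+ 2 :> R.
  by rewrite -muln2 natrM; field; rewrite gt_eqF.
have U0 : chebU (cox_cos i j) k.*2 = 0.
  by apply: (mulfI (lt0r_neq0 s0)); rewrite cE chebU_sin kpi sin2pi mulr0.
have U1 : chebU (cox_cos i j) k.*2.+1 = 1.
  apply: (mulfI (lt0r_neq0 s0)); rewrite cE chebU_sin -natr1 mulrDl kpi mul1r.
  by rewrite addrC sinD2pi mulr1.
(* The recursion read backwards from the indices [2 m] and [2 m + 1]. *)
have Um : chebU (cox_cos i j) k.*2.-1 = -1.
  have := chebUSS (cox_cos i j) k.*2.-1; rewrite !prednK //.
  by rewrite U0 U1 mulr0 sub0r => ->; rewrite opprK.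
have ej : simple_root j *m alt_mx i j k.*2 = simple_root j.
  by rewrite simple_alt_mx /= odd_double U0 U1 scale1r scale0r addr0.
have ei : simple_root i *m alt_mx i j k.*2 = simple_root i.
  rewrite -[k.*2]prednK //.
  rewrite /= mulmxA refl_self ?form_simplei // mulNmx simple_alt_mx.
  have -> : odd k.*2.-1 by have := odd_double k; rewrite -{1}(prednK k2gt) /= => /negbFE.
  rewrite /= (cox_cosC j i) prednK //.
  by rewrite U0 Um scaleN1r scale0r addr0 opprK.
by rewrite mulmxDl -!scalemxAl ei ej.
Qed.

(** Let [T] be the product of the two reflections.  Every [v T - v] lies in the
    plane of the two simple roots, where [T ^+ m i j] is the identity.  Hence
    [v T^m - v] lies in this plane and is fixed by [T]; but the only such vector
    is 0, because the plane is nondegenerate for [1 < m i j]. *)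
Lemma coxeter_relation i j :
  (reflection (simple_root i) *m reflection (simple_root j)) ^+ m i j = 1%:M.
Proof.
have [->|/eqP ij] := eqVneq i j.
  by rewrite m_diag expr1 refl_sq // form_simplei.
have [->|/eqP m0] := eqVneq (m i j) 0%N; first by rewrite expr0.
set T := _ *m _; set k := m i j in m0 *.
pose plane w := exists p q, w = p *: simple_root j + q *: simple_root i.
have planeD v w : plane v -> plane w -> plane (v + w).
  move=> [p [q ->]] [p' [q' ->]]; exists (p + p'), (q + q').
  by apply/rowP => l; rewrite !mxE; ring.
have planeN v : plane (v *m T - v).
  rewrite mulmxA !mul_refl.
  exists (- cox_form (v - cox_form v (simple_root i) *: simple_root i) (simple_root j)).
  exists (- cox_form v (simple_root i)).
  by apply/rowP => l; rewrite !mxE; ring.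
have planeT v : plane v -> plane (v *m T).
  by move=> pv; rewrite -[v *m T](subrK v); apply: planeD.
have fix0 w : plane w -> w *m T = w -> w = 0.
  move=> [p [q wE]] wT.
  have : w *m reflection (simple_root i) = w *m reflection (simple_root j).
    by rewrite -{2}wT -!mulmxA refl_sq ?form_simplei // mulmx1.
  rewrite !mul_refl => /addrI/oppr_inj E.
  have /eqP/negbTE ji : j <> i by move=> /esym.
  have fi : cox_form w (simple_root i) = 0.
    have := congr1 (fun x : 'rV_n => x 0 i) E.
    by rewrite !mxE !eqxx [i == j]eq_sym ji mulr1 mulr0.
  have fj : cox_form w (simple_root j) = 0.
    have := congr1 (fun x : 'rV_n => x 0 j) E.
    by rewrite !mxE !eqxx ji mulr1 mulr0.
  move: fi fj; rewrite wE !formDl !formZl !form_simplei !form_simple.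
  rewrite (cox_cosC j i) => fi fj.
  have c4 : 4 - cox_cos i j ^+ 2 != 0.
    by rewrite subr_eq0 eq_sym cox_cos_lt.
  have p0 : p = 0.
    apply: (mulfI c4); rewrite mulr0.
    have -> : (4 - cox_cos i j ^+ 2) * p =
      2 * (p * 2 + q * - cox_cos i j) + cox_cos i j * (p * - cox_cos i j + q * 2).
      ring.
    by rewrite fi fj !mulr0 addr0.
  have q0 : q = 0 by move: fi; rewrite p0 mul0r add0r; lra.
  by rewrite p0 q0 !scale0r addr0.
apply: row_mx_eq => v; rewrite mulmx1; apply/eqP; rewrite -subr_eq0.
apply/eqP/fix0.
  elim: (k) => [|l IH].
    by rewrite expr0 mulmx1 subrr; exists 0, 0; rewrite !scale0r addr0.
  rewrite exprSr -[_ * T]/(_ *m T) mulmxA -(subrK (v *m T) (_ *m T)) -mulmxBl.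
  by rewrite -addrA; apply: planeD => //; apply: planeT.
apply/eqP; rewrite -subr_eq0 mulmxBl -mulmxA.
have -> : T ^+ k *m T = T *m T ^+ k by rewrite -[LHS]exprSr -[RHS]exprS.
have [p [q E]] := planeN v.
have /eqP := plane_fixed p q ij m0.
rewrite -alt_mx_exp -/T -E -subr_eq0 mulmxBl mulmxA -/k => /eqP <-.
rewrite !mulmxA; apply/eqP; set y := v *m _ *m _.
set x := y *m _; set z := v *m T ^+ k; by rewrite !opprB addrACA [RHS]addrACA (addrC (- y)).

Qed.

End Geometric.

(** * Length, and positivity of roots *)

(** What is needed of a Coxeter group: generators satisfying the relations, the
    geometric representation, and the sign character, which forces lengths to
    change by exactly one under multiplication by a generator. *)
Record coxeter_rep (R : realType) (n : nat) (m : 'I_n -> 'I_n -> nat)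
    (G : groupType) (s : 'I_n -> G) (rho : G -> 'M[R]_n) (sgn : G -> R) : Prop :=
  CoxeterRep {
  cr_sym : forall i j, m i j = m j i;
  cr_diag : forall i, m i i = 1%N;
  cr_off : forall i j, i <> j -> m i j <> 1%N;
  cr_gen : forall g, exists w, g = (\prod_(i <- w) s i)%g;
  cr_rel : forall i j, ((s i * s j) ^+ m i j = 1)%g;
  cr_rho1 : rho 1%g = 1%:M;
  cr_rhoM : forall g h, rho (g * h)%g = rho g *m rho h;
  cr_rho_gen : forall i, rho (s i) = reflection m (simple_root R i);
  cr_sgn1 : sgn 1%g = 1;
  cr_sgnM : forall g h, sgn (g * h)%g = sgn g * sgn h;
  cr_sgn_gen : forall i, sgn (s i) = -1 }.

Lemma pigeonhole (T : eqType) (f : nat -> T) (l : seq T) :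
  (forall k, f k \in l) -> exists i j, (i < j)%N /\ f i = f j.
Proof.
move=> fl; pose g (k : 'I_(size l).+1) := f k.
have /injectivePn[i [j ij gij]] : ~~ injectiveb g.
  apply/negP => /injectiveP ginj.
  have : (size (codom g) <= size l)%N.
    apply: uniq_leq_size; first by rewrite map_inj_uniq ?enum_uniq.
    by move=> _ /codomP[k ->]; apply: fl.
  by rewrite size_codom card_ord ltnn.
move: ij; rewrite neq_ltn => /orP[] lt; first by exists i, j.
by exists j, i.
Qed.

Section Length.
Context (G : groupType) (n : nat) (s : 'I_n -> G).
Local Open Scope group_scope.

Definition wprod (w : seq 'I_n) : G := \prod_(i <- w) s i.

Hypothesis gen : forall g, exists w, g = wprod w.
Hypothesis s2 : forall i, s i * s i = 1.

Lemma wprod_cat u v : wprod (u ++ v) = wprod u * wprod v.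
Proof. exact: big_cat. Qed.

Lemma wprod_cons i v : wprod (i :: v) = s i * wprod v.
Proof. exact: big_cons. Qed.

Lemma wprod_rcons i v : wprod (rcons v i) = wprod v * s i.
Proof. by rewrite -cats1 wprod_cat wprod_cons /wprod big_nil mulg1. Qed.

Lemma len_subproof g : exists k, `[< exists w, size w = k /\ g = wprod w >].
Proof. by have [w gw] := gen g; exists (size w); apply/asboolP; exists w. Qed.

Definition word_len g : nat := ex_minn (len_subproof g).

Lemma lenP g : exists w, size w = word_len g /\ g = wprod w.
Proof. by rewrite /word_len; case: ex_minnP => k /asboolP. Qed.

Lemma len_min w : (word_len (wprod w) <= size w)%N.
Proof.
by rewrite /word_len; case: ex_minnP => k _; apply; apply/asboolP; exists w.
Qed.

Lemma len1 : word_len 1 = 0%N.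
Proof. by apply/eqP; rewrite -leqn0; have := len_min [::]; rewrite /wprod big_nil. Qed.

Lemma len0 g : word_len g = 0%N -> g = 1.
Proof.
by have [w [<- ->]] := lenP g; move/size0nil ->; rewrite /wprod big_nil.
Qed.

Lemma lenM g h : (word_len (g * h) <= word_len g + word_len h)%N.
Proof.
have [u [<- {1}->]] := lenP g; have [v [<- {1}->]] := lenP h.
by rewrite -wprod_cat -size_cat len_min.
Qed.

Lemma len_gen i : (word_len (s i) <= 1)%N.
Proof. by have := len_min [:: i]; rewrite /wprod big_cons big_nil mulg1. Qed.

Lemma s_inv i : (s i)^-1 = s i.
Proof. exact/mulg1_eq/s2. Qed.

Lemma genK i g : s i * (s i * g) = g.
Proof. by rewrite mulgA s2 mul1g. Qed.

Lemma wprodV w : (wprod w)^-1 = wprod (rev w).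
Proof.
elim: w => [|i w IH]; first by rewrite /wprod big_nil invg1.
by rewrite wprod_cons rev_cons wprod_rcons invgM IH s_inv.
Qed.

Lemma lenV_le g : (word_len g^-1 <= word_len g)%N.
Proof.
by have [w [<- ->]] := lenP g; rewrite wprodV -(size_rev w) len_min.
Qed.

Lemma lenV g : word_len g^-1 = word_len g.
Proof.
by apply/eqP; rewrite eqn_leq lenV_le /= -{1}(invgK g) lenV_le.
Qed.

Fixpoint alt_elt (i j : 'I_n) (k : nat) : G :=
  if k is k'.+1 then s i * alt_elt j i k' else 1.

Lemma alt_eltSr i j k : alt_elt i j k.+1 = alt_elt i j k * s (if odd k then j else i).
Proof.
elim: k i j => [|k IH] i j; first by rewrite /= mulg1 mul1g.
by rewrite -[alt_elt i j k.+2]/(s i * alt_elt j i k.+1) IH mulgA /=; case: (odd k).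
Qed.

Lemma len_alt i j k : (word_len (alt_elt i j k) <= k)%N.
Proof.
elim: k i j => [|k IH] i j /=; first by rewrite len1.
by rewrite (leq_trans (lenM _ _)) // (leq_add (len_gen i) (IH j i)).
Qed.

Lemma alt_eltD i j k l :
  exists2 x, alt_elt i j (k + l) = alt_elt i j k * x & (word_len x <= l)%N.
Proof.
elim: k i j => [|k IH] i j.
  by exists (alt_elt i j l); rewrite ?mul1g ?len_alt.
by have [x /= -> lx] := IH j i; exists x; rewrite ?mulgA.
Qed.

(** The inverse of an alternating product is the alternating product read
    backwards; so the two alternating products of [k] letters agree once
    [(s i * s j) ^+ k = 1]. *)
Lemma alt_elt_double i j k : alt_elt i j k.*2 = alt_elt i j k * (alt_elt j i k)^-1.
Proof.
elim: k i j => [|k IH] i j; first by rewrite /= invg1 mulg1.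
rewrite doubleS -[LHS]/(s i * alt_elt j i k.*2.+1) alt_eltSr odd_double IH /=.
by rewrite invgM s_inv !mulgA.
Qed.

Lemma alt_elt_exp i j k : (s i * s j) ^+ k = alt_elt i j k.*2.
Proof. by elim: k => // k IH; rewrite expgS IH doubleS /= mulgA. Qed.

Lemma alt_elt_braid i j k : (s i * s j) ^+ k = 1 -> alt_elt i j k = alt_elt j i k.
Proof. by rewrite alt_elt_exp alt_elt_double => /divg1_eq. Qed.

(** Balls for the word length are finite. *)
Lemma finite_order_of_bounded_len g K :
  (forall k, (word_len (g ^+ k) <= K)%N) -> exists2 k, (0 < k)%N & g ^+ k = 1.
Proof.
move=> bd.
pose T : finType := {k : 'I_K.+1 & k.-tuple 'I_n}.
have /choice[c cE] : forall k, exists t : T, g ^+ k = wprod (tagged t).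
  move=> k; have [w [sw gw]] := lenP (g ^+ k).
  have lt : (size w < K.+1)%N by rewrite ltnS sw.
  by exists (existT (fun k : 'I_K.+1 => k.-tuple 'I_n) (Ordinal lt) (in_tuple w)).
have [i [j [lt cij]]] : exists i j, (i < j)%N /\ c i = c j.
  by apply: (pigeonhole (l := enum T)) => k; rewrite mem_enum.
exists (j - i)%N; first by rewrite subn_gt0.
rewrite expgnFr; last exact: ltnW.
by rewrite !cE cij mulgV.
Qed.

End Length.

Section Positivity.
Context (R : realType) (n : nat) (m : 'I_n -> 'I_n -> nat)
  (G : groupType) (s : 'I_n -> G) (rho : G -> 'M[R]_n) (sgn : G -> R).
Hypothesis CR : coxeter_rep m s rho sgn.

Local Notation simple_root := (simple_root R).
Local Notation gen := (cr_gen CR).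
Local Notation word_len := (word_len gen).

Lemma gen_sq i : (s i * s i = 1)%g.
Proof. by have := cr_rel CR i i; rewrite (cr_diag CR) expg1. Qed.

Lemma sgn_len g : sgn g = (-1) ^+ word_len g.
Proof.
have [w [<- ->]] := lenP gen g; elim: w => [|i w IH].
  by rewrite /wprod big_nil (cr_sgn1 CR).
by rewrite wprod_cons (cr_sgnM CR) (cr_sgn_gen CR) IH exprS.
Qed.

Lemma len_genM i g :
  word_len (s i * g)%g = (word_len g).+1 \/ word_len g = (word_len (s i * g)%g).+1.
Proof.
have l1 := lenM gen (s i) g; have := len_gen gen i => li.
have l2 := lenM gen (s i) (s i * g)%g; rewrite (genK gen_sq) in l2.
have : word_len (s i * g)%g <> word_len g.
  move=> E; have := sgn_len (s i * g)%g; rewrite E -sgn_len (cr_sgnM CR) (cr_sgn_gen CR).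
  rewrite mulN1r => /eqP; rewrite -subr_eq0 -opprD oppr_eq0 -mulr2n mulrn_eq0 /=.
  by rewrite sgn_len signr_eq0.
lia.
Qed.

Lemma rho_alt i j k : rho (alt_elt s i j k) = alt_mx R m i j k.
Proof.
elim: k i j => [|k IH] i j; first by rewrite /= (cr_rho1 CR).
by rewrite /= (cr_rhoM CR) (cr_rho_gen CR) IH.
Qed.

Definition nonneg_row (v : 'rV[R]_n) : bool := [forall j, 0 <= v 0 j].

Lemma nonnegD v w : nonneg_row v -> nonneg_row w -> nonneg_row (v + w).
Proof.
by move=> /forallP v0 /forallP w0; apply/forallP => j; rewrite mxE addr_ge0.
Qed.

Lemma nonnegZ a v : 0 <= a -> nonneg_row v -> nonneg_row (a *: v).
Proof. by move=> a0 /forallP v0; apply/forallP => j; rewrite mxE mulr_ge0. Qed.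

Lemma nonneg_simple i : nonneg_row (simple_root i).
Proof. by apply/forallP => j; rewrite mxE ler0n. Qed.

(** Induction on the length of [g], after Tits.  Choose [j] with [s j * g] shorter
    than [g], and write [g] as a reduced product of an alternating word in [j]
    and [i], starting with [j] and as long as possible, and of an element [v].
    As the product is reduced and the word maximal, neither [s i] nor [s j]
    shortens [v], so that [v] maps both simple roots to nonnegative vectors; and the alternating word maps
    [simple_root i] to a nonnegative combination of both simple roots, because,
    if [m j i] is nonzero, it has fewer than [m j i] letters: otherwise the
    braid relation would make [s i * g] shorter than [g]. *)
Theorem simple_rho_ge0 i g :
  (word_len g < word_len (s i * g)%g)%N -> nonneg_row (simple_root i *m rho g).
Proof.
have [L] := ubnP (word_len g); elim: L i g => // L IH i g gL sg.
have [/(len0 (gen := gen)) ->|l0] := posnP (word_len g).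
  by rewrite (cr_rho1 CR) mulmx1 nonneg_simple.
have [j [g1 [gE lg1]]] : exists j g1, g = (s j * g1)%g /\ word_len g = (word_len g1).+1.
  have [[|j w] [sw gE]] := lenP gen g; first by rewrite -sw in l0.
  exists j, (wprod s w); rewrite -wprod_cons -gE; split=> //.
  have : (word_len (wprod s w) <= size w)%N by apply: len_min.
  have := len_genM j (wprod s w); rewrite -wprod_cons -gE; move: sw => /=; lia.
have ij : i <> j.
  by move=> E; move: sg; rewrite {2}gE E (genK gen_sq) lg1; lia.
(* [P k]: [g] has a reduced expression that starts with the alternating
   word of [k] letters. *)
pose P k := `[< exists v, g = (alt_elt s j i k * v)%g /\ word_len g = (k + word_len v)%N >].
have exP : exists k, P k.
  by exists 1%N; apply/asboolP; exists g1; rewrite /= mulg1 add1n.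
have leP k : P k -> (k <= word_len g)%N.
  by move=> /asboolP[v [_ ->]]; rewrite leq_addr.
have [k /asboolP[v [gv lv]] kmax] := ex_maxnP exP leP.
have k0 : (0 < k)%N.
  by apply: kmax; apply/asboolP; exists g1; rewrite /= mulg1 add1n.
have next : (word_len v < word_len (s (if odd k then i else j) * v)%g)%N.
  case: (len_genM (if odd k then i else j) v) => [->//|lv'].
  suff /kmax : P k.+1 by rewrite ltnn.
  apply/asboolP; exists (s (if odd k then i else j) * v)%g; split; last by lia.
  by rewrite alt_eltSr -mulgA (genK gen_sq).
have last : (word_len v < word_len (s (if odd k then j else i) * v)%g)%N.
  case: (len_genM (if odd k then j else i) v) => [->//|lv'].
  case: k k0 gv lv {kmax next} lv' => // k _ gv lv.
  have -> : (if odd k.+1 then j else i) = (if odd k then i else j).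
    by rewrite /=; case: (odd k).
  move=> lv'; move: gv; rewrite alt_eltSr -mulgA => gv.
  have := lenM gen (alt_elt s j i k) (s (if odd k then i else j) * v)%g.
  by rewrite -gv; have := len_alt gen j i k; lia.
have vL : (word_len v < L)%N by lia.
have vi : nonneg_row (simple_root i *m rho v).
  by apply: IH => //; move: next last; case: (odd k).
have vj : nonneg_row (simple_root j *m rho v).
  by apply: IH => //; move: next last; case: (odd k).
have km : m j i = 0%N \/ (k < m j i)%N.
  have [->|m0] := eqVneq (m j i) 0%N; [by left|right].
  rewrite ltnNge; apply/negP => mk.
  have [x xE lx] := alt_eltD gen j i (m j i) (k - m j i).
  rewrite subnKC // in xE.
  have E := alt_elt_braid gen_sq (cr_rel CR j i).
  have mE : m j i = (m j i).-1.+1 by rewrite prednK // lt0n.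
  have : (s i * g = alt_elt s j i (m j i).-1 * (x * v))%g.
    by rewrite gv xE E mE /= -!mulgA (genK gen_sq).
  move=> sgE; have := lenM gen (alt_elt s j i (m j i).-1) (x * v)%g.
  rewrite -sgE; have := len_alt gen j i (m j i).-1; have := lenM gen x v.
  lia.
have [p [q [p0 q0 E]]] := simple_alt_mx_ge0 R (cr_sym CR) (cr_diag CR) (cr_off CR)
   (fun ji => ij (esym ji)) km.
rewrite gv (cr_rhoM CR) rho_alt mulmxA E mulmxDl -!scalemxAl.
by apply: nonnegD; apply: nonnegZ.
Qed.

End Positivity.

(** * Inversions *)

Section Inversions.
Context (R : realType) (n : nat) (m : 'I_n -> 'I_n -> nat)
  (G : groupType) (s : 'I_n -> G) (rho : G -> 'M[R]_n) (sgn : G -> R).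
Hypothesis CR : coxeter_rep m s rho sgn.

Local Notation simple_root := (simple_root R).
Local Notation gen := (cr_gen CR).
Local Notation word_len := (word_len gen).
Local Notation cox_form := (cox_form m).
Local Notation reflection := (reflection m).

Definition is_root (b : 'rV[R]_n) : Prop := exists i g, b = simple_root i *m rho g.

Lemma rho_isometry g : isometry m (rho g).
Proof.
have [w ->] := gen g; elim: w => [|i w IH] v v'.
  by rewrite big_nil (cr_rho1 CR) !mulmx1.
rewrite big_cons (cr_rhoM CR) !mulmxA IH (cr_rho_gen CR) refl_form //.
  exact: cr_sym CR.
exact: form_simplei (cr_diag CR) i.
Qed.

Lemma rhoVM g : rho g^-1%g *m rho g = 1%:M.
Proof. by rewrite -(cr_rhoM CR) mulVg (cr_rho1 CR). Qed.

Lemma rhoMV g : rho g *m rho g^-1%g = 1%:M.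
Proof. by rewrite -(cr_rhoM CR) mulgV (cr_rho1 CR). Qed.

Lemma rhoK g (v : 'rV[R]_n) : v *m rho g *m rho g^-1%g = v.
Proof. by rewrite -mulmxA rhoMV mulmx1. Qed.

Lemma rhoVK g (v : 'rV[R]_n) : v *m rho g^-1%g *m rho g = v.
Proof. by rewrite -mulmxA rhoVM mulmx1. Qed.

Lemma rhoX g k : rho (g ^+ k)%g = rho g ^+ k.
Proof.
elim: k => [|k IH]; first by rewrite expg0 expr0 (cr_rho1 CR).
by rewrite expgS exprS (cr_rhoM CR) IH.
Qed.

Lemma root_form b : is_root b -> cox_form b b = 2.
Proof. by move=> [i [g ->]]; rewrite rho_isometry (form_simplei R (cr_diag CR)). Qed.

Lemma root_simple i : is_root (simple_root i).
Proof. by exists i, 1%g; rewrite (cr_rho1 CR) mulmx1. Qed.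

Lemma root_rho b g : is_root b -> is_root (b *m rho g).
Proof. by move=> [i [h ->]]; exists i, (h * g)%g; rewrite (cr_rhoM CR) mulmxA. Qed.

Lemma rootN b : is_root b -> is_root (- b).
Proof.
move=> [i [g ->]]; exists i, (s i * g)%g.
rewrite (cr_rhoM CR) mulmxA (cr_rho_gen CR) refl_self ?mulNmx //.
exact: form_simplei (cr_diag CR) i.
Qed.

Lemma root_refl b : is_root b -> exists g, rho g = reflection b.
Proof.
move=> [i [g ->]]; exists (g^-1 * s i * g)%g.
rewrite !(cr_rhoM CR) (cr_rho_gen CR).
by apply: refl_conj; [apply: rho_isometry|apply: rhoVM].
Qed.

(** For [b = simple_root i *m rho g], either [s i * g] is longer than [g] and
    [simple_rho_ge0] applies to [g], or it is shorter and [simple_rho_ge0] applies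
    to [s i * g]. *)
Lemma nonnegN b : is_root b -> nonneg_row (- b) = ~~ nonneg_row b.
Proof.
move=> rb; case: (boolP (nonneg_row b)) => [b0|bn].
  apply/negP => bN0; have := root_form rb; suff -> : b = 0.
    by rewrite /cox_form !mul0mx mxE => /eqP; rewrite eq_sym pnatr_eq0.
  apply/rowP => j; have /forallP/(_ j) := b0; have /forallP/(_ j) := bN0.
  rewrite !mxE oppr_ge0 => h1 h2; apply/eqP; by rewrite eq_le h1.
move: rb bn => [i [g ->]].
case: (len_genM CR i g) => h.
  by rewrite (simple_rho_ge0 (CR := CR)) // h.
move=> _; have := simple_rho_ge0 (CR := CR) (i := i) (g := (s i * g)%g).
rewrite (genK (gen_sq CR)) h ltnSn => /(_ isT).
rewrite (cr_rhoM CR) mulmxA (cr_rho_gen CR) refl_self ?mulNmx //.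
exact: form_simplei (cr_diag CR) i.
Qed.

Lemma nonnegNN b : is_root b -> nonneg_row b = ~~ nonneg_row (- b).
Proof. by move=> rb; rewrite nonnegN // negbK. Qed.

(** A simple reflection changes one coordinate only. *)
Lemma simple_flip b i :
  is_root b -> nonneg_row b -> ~~ nonneg_row (b *m rho (s i)) -> b = simple_root i.
Proof.
move=> rb b0; rewrite -nonnegN; last exact: root_rho.
rewrite (cr_rho_gen CR) mul_refl => /forallP bN.
have bE : b = b 0 i *: simple_root i.
  apply/rowP => j; rewrite !mxE eqxx /=; have [->|ji] := eqVneq j i.
    by rewrite mulr1.
  have := bN j; rewrite !mxE eqxx /= (negbTE ji) mulr0 subr0 mulr0 oppr_ge0 => h.
  by apply/eqP; rewrite eq_le h (forallP b0).
have := root_form rb; rewrite bE formZl (form_sym (cr_sym CR)) formZl.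
rewrite (form_simplei R (cr_diag CR)) => E.
suff -> : b 0 i = 1 by rewrite scale1r.
have b00 : 0 <= b 0 i by have /forallP := b0.
nra.
Qed.

Definition inverts (g : G) (b : 'rV[R]_n) : Prop :=
  [/\ is_root b, nonneg_row b & ~~ nonneg_row (b *m rho g)].

Lemma inverts_gen b g i : inverts (g * s i)%g b ->
  inverts g b \/ b = simple_root i *m rho g^-1%g.
Proof.
move=> [rb b0]; rewrite (cr_rhoM CR) mulmxA => bgs.
case: (boolP (nonneg_row (b *m rho g))) => [bg|bg]; last by left.
right; rewrite -(simple_flip _ _ bgs) ?rhoK //; exact: root_rho.
Qed.

(** Each letter of a word contributes at most one inversion. *)
Lemma inversions_subproof g : exists l : seq 'rV[R]_n,
  [/\ uniq l, forall b, b \in l <-> inverts g b & (size l <= word_len g)%N].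
Proof.
have [l [sl gl]] : exists l : seq 'rV[R]_n,
    (size l <= word_len g)%N /\ forall b, inverts g b -> b \in l.
  have [w [<- ->]] := lenP gen g; elim/last_ind: w => [|w i [l [sl IH]]].
    exists [::]; split=> // b [_]; rewrite /wprod big_nil (cr_rho1 CR) mulmx1.
    by move=> ->.
  exists (simple_root i *m rho (wprod s w)^-1%g :: l); split; first by rewrite size_rcons.
  move=> b; rewrite wprod_rcons => /inverts_gen[/IH|->].
    by rewrite inE => ->; rewrite orbT.
  by rewrite inE eqxx.
exists (undup [seq b <- l | `[< inverts g b >]]); split.
- exact: undup_uniq.
- move=> b; rewrite mem_undup mem_filter; split; first by move=> /andP[/asboolP].
  by move=> gb; rewrite gl // andbT; apply/asboolP.
by rewrite (leq_trans (size_undup _)) // size_filter (leq_trans (count_size _ _)).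
Qed.

Definition inversions g : seq 'rV[R]_n := projT1 (cid (inversions_subproof g)).

Lemma inversions_uniq g : uniq (inversions g).
Proof. by rewrite /inversions; case: cid => l []. Qed.

Lemma inversionsP g b : b \in inversions g <-> inverts g b.
Proof. by rewrite /inversions; case: cid => l []. Qed.

Lemma size_inversions_le g : (size (inversions g) <= word_len g)%N.
Proof. by rewrite /inversions; case: cid => l []. Qed.

(** Removing the last letter of a reduced word removes an inversion. *)
Lemma len_le_inversions g : (word_len g <= size (inversions g))%N.
Proof.
have [L] := ubnP (word_len g); elim: L g => // L IH g gL.
have [[|i w] [sw gE]] := lenP gen g^-1%g.
  by rewrite -(lenV gen (gen_sq CR) g) -sw.
pose g1 := (g * s i)%g.
have g1V : g1^-1%g = wprod s w.
  by rewrite /g1 invgM (s_inv (gen_sq CR)) gE wprod_cons (genK (gen_sq CR)).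
have lg : word_len g = (size w).+1 by rewrite -(lenV gen (gen_sq CR)) -sw.
have lg1 : word_len g = (word_len g1).+1.
  have := len_min gen w; rewrite -g1V (lenV gen (gen_sq CR)).
  have := len_genM CR i g^-1%g; rewrite gE wprod_cons (genK (gen_sq CR)) -g1V.
  have E : (s i * g1^-1 = g^-1)%g by rewrite gE wprod_cons g1V.
  rewrite E !(lenV gen (gen_sq CR)); lia.
have g1E : g = (g1 * s i)%g by rewrite /g1 -mulgA (gen_sq CR) mulg1.
pose b := simple_root i *m rho g1^-1%g.
have rb : is_root b by exists i, g1^-1%g.
have b0 : nonneg_row b.
  apply: (simple_rho_ge0 (CR := CR)); rewrite (lenV gen (gen_sq CR)).
  have -> : (s i * g1^-1 = g^-1)%g by rewrite gE wprod_cons g1V.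
  by rewrite (lenV gen (gen_sq CR)) lg1.
have bg1 : b \notin inversions g1.
  apply/negP => /inversionsP [_ _]; rewrite /b rhoVK.
  by rewrite nonneg_simple.
rewrite lg1; apply: (leq_ltn_trans (IH g1 _)); first by lia.
rewrite -[X in (X <= _)%N]/(size (b :: inversions g1)).
apply: uniq_leq_size; first by rewrite /= bg1 inversions_uniq.
move=> c; rewrite inE => /orP[/eqP ->|/inversionsP[rc c0 cg1]].
  apply/inversionsP; split=> //.
  rewrite g1E (cr_rhoM CR) mulmxA rhoVK (cr_rho_gen CR).
  rewrite refl_self ?(form_simplei R (cr_diag CR)) //.
  by rewrite nonnegN ?nonneg_simple //; apply: root_simple.
apply/inversionsP; split=> //; apply/negP => cg.
have rcg1 : is_root (c *m rho g1) by apply: root_rho.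
have : - (c *m rho g1) = simple_root i.
  apply: simple_flip; rewrite ?nonnegN //; first exact: rootN.
  rewrite mulNmx nonnegN; last exact: root_rho.
  by rewrite negbK -mulmxA -(cr_rhoM CR) -g1E.
move=> /(congr1 (fun v => v *m rho g1^-1%g)); rewrite mulNmx rhoK -/b => cb.
by move: b0; rewrite -cb nonnegN // c0.
Qed.

Lemma size_inversions g : size (inversions g) = word_len g.
Proof. by apply/eqP; rewrite eqn_leq size_inversions_le len_le_inversions. Qed.

End Inversions.

(** * Colours of walls and medians *)

(** The counts of medians in injective form: each code ranges over a finite type
    whose cardinality is the bound.  By symmetry the first code also bounds the
    number of medians for a given second argument. *)
Definition median_coding (G : groupType) (word_len : G -> nat) (L : eqType)
    (med : G -> G -> L) (Q : finType) : Prop :=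
  forall K,
  [/\ forall y x, med y x = med x y,
      exists c : G -> G -> {ffun Q -> 'I_K.+1}, forall x y z,
        (word_len (x^-1 * y)%g <= K)%N -> (word_len (x^-1 * z)%g <= K)%N ->
        c x y = c x z -> med x y = med x z &
      exists c : G -> G -> {ffun Q -> 'I_K.+1} * Q, forall w y z,
        (word_len w <= K)%N -> med y (y * w)%g = med z (z * w)%g ->
        c w y = c w z -> y = z].

Section Medians.
Context (R : realType) (n : nat) (m : 'I_n -> 'I_n -> nat)
  (G : groupType) (s : 'I_n -> G) (rho : G -> 'M[R]_n) (sgn : G -> R).
Hypothesis CR : coxeter_rep m s rho sgn.

Local Notation simple_root := (simple_root R).
Local Notation gen := (cr_gen CR).
Local Notation word_len := (word_len gen).
Local Notation cox_form := (cox_form m).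
Local Notation reflection := (reflection m).
Local Notation is_root := (is_root rho).
Local Notation inversions := (inversions CR).

Definition cox_denom : nat := (\prod_i \prod_j maxn 1 (m i j))%N.

Local Notation integral_mx X := (zspan_mx (@cos_gen R cox_denom) X).

Lemma cox_denom_gt0 : (0 < cox_denom)%N.
Proof. by apply: prodn_gt0 => i; apply: prodn_gt0 => j; rewrite leq_max. Qed.

Lemma dvdn_cox_denom i j : m i j <> 0%N -> (m i j %| cox_denom)%N.
Proof.
move=> m0; rewrite /cox_denom (bigD1 i) //= (bigD1 j) //=.
have /maxn_idPr -> : (1 <= m i j)%N by lia.
by rewrite -mulnA dvdn_mulr.
Qed.

Let Aord := cos_order R cox_denom_gt0.

Lemma zspan_cox_cos i j : zspan (@cos_gen R cox_denom) (cox_cos R m i j).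
Proof.
rewrite /cox_cos; case: eqVneq => [_|/eqP m0]; first exact: (zspan_int Aord 2).
have /dvdnP[q qE] := dvdn_cox_denom m0.
suff -> : 2 * cos (pi / (m i j)%:R) = cos2 R cox_denom q.
  exact: (zspan_cos2 _ cox_denom_gt0).
rewrite /cos2; congr (_ * cos _).
have m0R : (m i j)%:R != 0 :> R by rewrite pnatr_eq0; apply/eqP.
have q0R : q%:R != 0 :> R.
  by rewrite pnatr_eq0; apply/eqP => q0; have := cox_denom_gt0; rewrite qE q0.
rewrite [in RHS]qE natrM; field; exact/andP.
Qed.

Lemma zspan_simple (i : 'I_n) : integral_mx (simple_root i).
Proof.
move=> k l; rewrite mxE; case: (_ && _); first exact: (zspan_int Aord 1).
exact: zspan0.
Qed.

Lemma zspan_rho g : integral_mx (rho g).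
Proof.
have [w ->] := gen g; elim: w => [|i w IH].
  by rewrite big_nil (cr_rho1 CR); apply: zspan_mx1.
rewrite big_cons (cr_rhoM CR); apply: zspan_mxM => //.
rewrite (cr_rho_gen CR) /reflection; apply: zspan_mxD; first exact: zspan_mx1.
apply/zspan_mxN/zspan_mxM => //; last exact: zspan_simple.
apply: zspan_mxM => //.
  by move=> k l; rewrite mxE; apply: zspanN; apply: zspan_cox_cos.
by move=> k l; rewrite mxE; apply: zspan_simple.
Qed.

Lemma zspan_root b : is_root b -> integral_mx b.
Proof.
by move=> [i [g ->]]; apply: zspan_mxM => //; [apply: zspan_simple|apply: zspan_rho].
Qed.

Lemma zspan_refl b : is_root b -> integral_mx (reflection b).
Proof. by move=> /(root_refl CR)[g <-]; apply: zspan_rho. Qed.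

Lemma mem_inversions g b : is_root b ->
  (b \in inversions g) = nonneg_row b && ~~ nonneg_row (b *m rho g).
Proof.
move=> rb; apply/idP/andP => [/inversionsP[]|[b0 bg]] //.
by apply/inversionsP; split.
Qed.

(** The roots [a *m rho h ^+ k], where [h] is the product of the two reflections,
    lie in the plane of [a] and [b].  A root with two coordinates of the same
    sign separates 1 from [x], up to sign, and one with coordinates of
    opposite signs separates [y] from [z]; so there are finitely many of them,
    some power of [h] fixes [a], and then [h] fixes [a] by [minkowski].  So the
    reflection in [b] maps [a] to its opposite, which forces [a = b]. *)
Lemma four_quadrants a b x y z :
  cong3 (@cos_gen R cox_denom) (reflection a) (reflection b) ->
  a \in inversions x -> b \in inversions x ->
  a \in inversions y -> b \notin inversions y ->
  a \notin inversions z -> b \in inversions z -> a = b.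
Proof.
move=> ab ax bx ay + + bz.
have /inversionsP[ra a0 _] := ax; have /inversionsP[rb b0 _] := bx.
move: ax bx ay bz; rewrite !mem_inversions // a0 b0 /=.
move=> ax bx ay bz /negbNE/= bY /negbNE/= aZ.
have [h hE] : exists h, rho h = reflection a *m reflection b.
  have [g <-] := root_refl CR ra; have [g' <-] := root_refl CR rb.
  by exists (g * g')%g; rewrite (cr_rhoM CR).
have h1 : cong3 (@cos_gen R cox_denom) (rho h) 1%:M.
  rewrite hE -(refl_sq (root_form CR rb)).
  by apply: cong3_mulr => //; apply: zspan_refl.
(* All roots of the orbit lie in this list, up to sign. *)
pose L := inversions x ++ inversions y ++ inversions z.
have cover c p q : is_root c -> c = p *: a + q *: b -> 0 <= p ->
    c \in L ++ [seq - d | d <- L].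
  move=> rc cE p0.
  have mem_opp : - c \in L -> c \in L ++ [seq - d | d <- L].
    by move=> cL; rewrite mem_cat -[c]opprK map_f ?orbT ?opprK.
  have rNc := rootN CR rc.
  case: (leP 0 q) => [q0|/ltW q0].
    rewrite !mem_cat mem_inversions //.
    have -> : nonneg_row c by rewrite cE nonnegD ?nonnegZ.
    rewrite -(nonnegN CR); last exact: (root_rho CR).
    have -> // : nonneg_row (- (c *m rho x)).
    rewrite cE mulmxDl -!scalemxAl opprD -!scalerN nonnegD // nonnegZ //.
      by rewrite (nonnegN CR) //; apply: (root_rho CR).
    by rewrite (nonnegN CR) //; apply: (root_rho CR).
  case: (boolP (nonneg_row c)) => c0.
    rewrite !mem_cat !mem_inversions // c0 /=.
    have -> : ~~ nonneg_row (c *m rho y); last by rewrite orbT.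
    rewrite -(nonnegN CR); last exact: (root_rho CR).
    rewrite cE mulmxDl -!scalemxAl opprD -scalerN -scaleNr nonnegD // nonnegZ //.
      by rewrite (nonnegN CR) //; apply: (root_rho CR).
    by rewrite oppr_ge0.
  apply: mem_opp; rewrite !mem_cat !mem_inversions // (nonnegN CR) // c0 /=.
  have -> : ~~ nonneg_row (- c *m rho z); last by rewrite !orbT.
  rewrite mulNmx -(nonnegNN CR); last exact: (root_rho CR).
  rewrite cE mulmxDl -!scalemxAl -[q]opprK scaleNr -scalerN nonnegD // nonnegZ //.
    by rewrite oppr_ge0.
  by rewrite (nonnegN CR) //; apply: (root_rho CR).
have plane k : exists p q, a *m rho (h ^+ k)%g = p *: a + q *: b.
  elim: k => [|k [p [q IH]]].
    by exists 1, 0; rewrite expg0 (cr_rho1 CR) mulmx1 scale1r scale0r addr0.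
  rewrite expgSr (cr_rhoM CR) mulmxA IH hE mulmxA !mul_refl.
  set f := cox_form _ a; set f' := cox_form _ b.
  exists (p - f), (q - f'); apply/rowP => l; rewrite !mxE; ring.
have [i [j [lt E]]] : exists i j, (i < j)%N /\ a *m rho (h ^+ i)%g = a *m rho (h ^+ j)%g.
  apply: (pigeonhole (l := L ++ [seq - d | d <- L])) => k.
  have [p [q E]] := plane k; have rk := root_rho CR (h ^+ k)%g ra.
  case: (leP 0 p) => [p0|/ltW p0]; first exact: (cover _ p q).
  have := cover _ (- p) (- q) (rootN CR rk); rewrite E oppr_ge0 => /(_ _ p0).
  rewrite opprD !scaleNr => /(_ erefl).
  rewrite !(mem_cat _ L) => /orP[pL|/mapP[d dL dE]].
    by rewrite -[X in _ || (X \in _)]opprK map_f ?orbT // opprD.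
  by rewrite -[X in X \in L]opprK opprD dE opprK dL.
have fixa : a *m rho h ^+ (j - i) = a.
  rewrite -(rhoX CR) expgnFr; last exact: ltnW.
  by rewrite (cr_rhoM CR) mulmxA -E (rhoK CR).
have ah : a *m rho h = a.
  by apply: (minkowski Aord _ h1 _ fixa); rewrite ?subn_gt0 //; apply: zspan_root.
move: ah; rewrite hE mulmxA (refl_self (root_form CR ra)) mulNmx mul_refl.
rewrite opprB => /eqP; rewrite subr_eq => /eqP; set f := cox_form a b => fab.
have aE : a = (f / 2) *: b.
  rewrite mulrC -scalerA fab -mulr2n -[a *+ 2]scaler_nat scalerA mulVf ?scale1r //.
(* If [f] were negative, [a] and its opposite would be positive. *)
have f0 : 0 <= f.
  rewrite leNgt; apply/negP => f0; have := nonnegN CR ra; rewrite a0 aE -scaleNr.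
  by rewrite nonnegZ // -mulNr divr_ge0 // oppr_ge0 ltW.
have := root_form CR ra; rewrite aE formZl (form_sym (cr_sym CR)) formZl.
rewrite (root_form CR rb) => ff.
have -> : f = 2 by nra.
by rewrite divff ?scale1r // pnatr_eq0.
Qed.

Definition common_inversions (x y : G) : seq 'rV[R]_n :=
  [seq b <- inversions x | b \in inversions y].

Lemma common_uniq x y : uniq (common_inversions x y).
Proof. by rewrite filter_uniq // inversions_uniq. Qed.

Lemma mem_common x y b :
  (b \in common_inversions x y) = (b \in inversions x) && (b \in inversions y).
Proof. by rewrite mem_filter andbC. Qed.

Lemma size_common_l x y : (size (common_inversions x y) <= word_len x)%N.
Proof. by rewrite -(size_inversions CR) size_filter count_size. Qed.

Lemma size_common_r x y : (size (common_inversions x y) <= word_len y)%N.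
Proof.
rewrite -(size_inversions CR); apply: uniq_leq_size; first exact: common_uniq.
by move=> b; rewrite mem_common => /andP[].
Qed.

Lemma commonC x y : common_inversions x y =i common_inversions y x.
Proof. by move=> b; rewrite !mem_common andbC. Qed.

Lemma inversions_root g b : b \in inversions g -> is_root b.
Proof. by move=> /inversionsP[]. Qed.

Section Colour.
Context (Q : finType) (colour : 'M[R]_n -> Q).
Hypothesis colourP : forall X Y, integral_mx X -> integral_mx Y -> colour X = colour Y ->
  cong3 (@cos_gen R cox_denom) X Y.

Definition colour_count x y q : nat :=
  count (fun b => colour (reflection b) == q) (common_inversions x y).

(** If the two sets differed, then in some colour neither would contain the other,
    as they have equally many elements there; two walls witnessing this are
    crossing walls of the same colour. *)
Lemma common_determined x y z :
  (forall q, colour_count x y q = colour_count x z q) ->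
  common_inversions x y = common_inversions x z.
Proof.
wlog suff : y z / (forall q, colour_count x y q = colour_count x z q) ->
    {subset common_inversions x y <= common_inversions x z}.
  move=> H E; apply: eq_in_filter => b bx.
  have := H z y (fun q => esym (E q)) b; have := H y z E b.
  rewrite !mem_common bx /= => h1 h2; apply/idP/idP; [exact: h1|exact: h2].
move=> E b bxy; apply/negPn/negP => bxz.
pose col l := [seq c <- l | colour (reflection c) == colour (reflection b)].
have [c cz cy] : exists2 c,
    c \in col (common_inversions x z) & c \notin col (common_inversions x y).
  apply/allPn/negP => /allP sub.
  have := uniq_min_size (filter_uniq _ (common_uniq x z)) sub.
  rewrite !size_filter -!/(colour_count _ _ _) E leqnn => /(_ isT)[_ /(_ b)].
  by rewrite ![_ \in col _]mem_filter eqxx /= (negbTE bxz) bxy.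
move: cz cy; rewrite ![_ \in col _]mem_filter => /andP[/eqP cb cz].
rewrite cb eqxx /= => cy; move: bxy bxz cz cy; rewrite !mem_common.
move=> /andP[bx bY]; rewrite bx /= => bz /andP[cx cz]; rewrite cx /= => cy.
have bc : b = c.
  apply: (@four_quadrants b c x y z) => //; apply: colourP => //; apply: zspan_refl.
    exact: inversions_root bx.
  exact: inversions_root cx.
by move: cy; rewrite -bc bY.
Qed.

Definition colour_code K x y : {ffun Q -> 'I_K.+1} :=
  [ffun q => inord (colour_count x y q)].

Lemma colour_code_determined K x y z :
  (size (common_inversions x y) <= K)%N -> (size (common_inversions x z) <= K)%N ->
  colour_code K x y = colour_code K x z -> common_inversions x y = common_inversions x z.
Proof.
move=> yK zK E; apply: common_determined => q.
have /ffunP/(_ q) := E; rewrite !ffunE => /(congr1 val) /=.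
have lt v : (size (common_inversions x v) <= K)%N -> (colour_count x v q < K.+1)%N.
  by move=> vK; rewrite ltnS (leq_trans (count_size _ _)).
by rewrite !inordK ?lt.
Qed.

End Colour.

Definition median (y x : G) : {fset 'rV[R]_n} := [fset b in common_inversions y x]%fset.

Lemma mem_median y x b : (b \in median y x) = (b \in common_inversions y x).
Proof. by rewrite in_fset. Qed.

Lemma medianC y x : median y x = median x y.
Proof. by apply/fsetP => b; rewrite !mem_median commonC. Qed.

(** Seen from [x], the walls between [x] and the median of 1, [x], [y] are the
    common inversions of [x^-1] and [x^-1 * y]. *)
Lemma median_determined x y z :
  common_inversions x^-1%g (x^-1 * y)%g =i common_inversions x^-1%g (x^-1 * z)%g ->
  median y x = median z x.
Proof.
move=> E; apply/fsetP => b; rewrite !mem_median !mem_common.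
case bx: (b \in inversions x); last by rewrite !andbF.
rewrite !andbT; have rb := inversions_root bx.
have := bx; rewrite mem_inversions // => /andP[b0 bxN].
have := E (- (b *m rho x)).
have rbx : is_root (- (b *m rho x)) by apply: (rootN CR); apply: (root_rho CR).
rewrite !mem_common !mem_inversions // !(cr_rhoM CR) !mulNmx !mulmxA !(rhoK CR).
rewrite !(nonnegN CR) ?bxN ?b0 //=; try exact: (root_rho CR).
by rewrite !negbK => ->.
Qed.

(** The median as a choice of a side for every wall, a negative root standing for
    the negative side of its opposite; [M] is the set of walls which separate
    it from 1. *)
Definition majority (M : seq 'rV[R]_n) (b : 'rV[R]_n) : bool :=
  if nonneg_row b then b \notin M else - b \in M.

(** Both sides say that at least two of the elements 1, [y], [y * w] lie on the
    side [b] of its wall, and this condition is equivariant. *)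
Lemma majority_shift y w b : is_root b ->
  majority (common_inversions y (y * w)%g) b =
  majority (common_inversions w y^-1%g) (b *m rho y).
Proof.
move=> rb; rewrite /majority.
have rby := root_rho CR y rb; have rbyw := root_rho CR w rby.
have rNb := rootN CR rb; have rNby := rootN CR rby.
rewrite !mem_common !mem_inversions // !mulNmx !(cr_rhoM CR) !mulmxA !(rhoK CR).
rewrite !(nonnegN CR) //.
case: (nonneg_row b); case: (nonneg_row (b *m rho y)); case: (nonneg_row _) => //=.
Qed.

Lemma rho_inj1 g : rho g = 1%:M -> g = 1%g.
Proof.
move=> g1; apply: (len0 (gen := gen)); rewrite -(size_inversions CR).
apply/eqP; rewrite size_eq0; apply/eqP; case E: (inversions g) => [//|b l].
have : b \in inversions g by rewrite E inE eqxx.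
by move=> /inversionsP[_ b0]; rewrite g1 mulmx1 b0.
Qed.

(** The element [g = y * z^-1] maps the median to itself.  Hence so do its powers,
    and a wall separating 1 from [g ^+ k] separates the median from one of
    them, which leaves [2 |M|] possibilities.  Therefore [g] has finite order,
    and it is trivial because it is congruent to 1 modulo 3. *)
Lemma median_stabiliser (Q : finType) (colour : 'M[R]_n -> Q)
  (colourP : forall X Y, integral_mx X -> integral_mx Y -> colour X = colour Y ->
     cong3 (@cos_gen R cox_denom) X Y)
  w y z : median y (y * w)%g = median z (z * w)%g ->
  common_inversions w y^-1%g = common_inversions w z^-1%g ->
  colour (rho y) = colour (rho z) -> y = z.
Proof.
move=> Myz Eyz Lyz; pose M := common_inversions y (y * w)%g.
pose g := (y * z^-1)%g.
have maj_g b : is_root b -> majority M (b *m rho g) = majority M b.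
  move=> rb; rewrite [RHS]majority_shift // Eyz.
  have -> : majority M (b *m rho g) = majority (common_inversions z (z * w)%g) (b *m rho g).
    by rewrite /majority -!mem_median Myz !mem_median.
  rewrite majority_shift; last exact: (root_rho CR).
  by rewrite /g (cr_rhoM CR) !mulmxA (rhoVK CR).
have maj_gk b k : is_root b -> majority M (b *m rho (g ^+ k)%g) = majority M b.
  move=> rb; elim: k => [|k IH]; first by rewrite expg0 (cr_rho1 CR) mulmx1.
  by rewrite expgSr (cr_rhoM CR) mulmxA maj_g //; apply: (root_rho CR).
have [k k0 gk] : exists2 k, (0 < k)%N & (g ^+ k = 1)%g.
  apply: (@finite_order_of_bounded_len _ _ _ gen _ (size M + size M)) => k.
  rewrite -(size_inversions CR).
  rewrite -{2}(size_map (fun b => - (b *m rho (g ^+ k)^-1%g)) M) -size_cat.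
  apply: uniq_leq_size; first exact: inversions_uniq.
  move=> b bk; have rb := inversions_root bk; move: bk.
  rewrite mem_inversions // => /andP[b0 bk]; rewrite mem_cat.
  have := maj_gk b k rb; rewrite /majority b0 (negbTE bk).
  case: (b \in M) => //= bkM; apply/mapP; exists (- (b *m rho (g ^+ k)%g)) => //.
  by rewrite mulNmx (rhoK CR) opprK.
have g1 : cong3 (@cos_gen R cox_denom) (rho g) 1%:M.
  rewrite /g (cr_rhoM CR) -(rhoMV CR z).
  by apply: (cong3_mulr Aord); [apply: zspan_rho|apply: colourP => //; apply: zspan_rho].
have : rho g = 1%:M.
  apply/row_matrixP => i; rewrite !rowE mulmx1.
  apply: (minkowski Aord k0 g1); first exact: zspan_simple.
  by rewrite -(rhoX CR) gk (cr_rho1 CR) mulmx1.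
by move=> /rho_inj1/divg1_eq.
Qed.

Theorem median_codes : exists (L : eqType) (med : G -> G -> L) (Q : finType),
  median_coding word_len med Q.
Proof.
have [Q [colour colourP]] := cong3_label (@cos_gen R cox_denom) n n.
exists {fset 'rV[R]_n}, median, Q => K; split.
- exact: medianC.
- exists (fun x y => colour_code colour K x^-1%g (x^-1 * y)%g) => x y z yK zK E.
  rewrite medianC [RHS]medianC; apply: median_determined => b.
  by rewrite (colour_code_determined colourP _ _ E) // (leq_trans (size_common_r _ _)).
exists (fun w y => (colour_code colour K w y^-1%g, colour (rho y))) => w y z wK med [E Eyz].
apply: (median_stabiliser colourP med) => //.
by apply: (colour_code_determined colourP _ _ E); rewrite (leq_trans (size_common_l _ _)).
Qed.

End Medians.

(** * A Schur test for kernels grouped by labels *)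

Section Schur.
Context (R : realFieldType).

(** The discriminant of a nonnegative quadratic polynomial. *)
Lemma cauchy_schwarz (I : Type) (r : seq I) (P : pred I) (F H : I -> R) :
  (\sum_(i <- r | P i) F i * H i) ^+ 2 <=
  (\sum_(i <- r | P i) F i ^+ 2) * (\sum_(i <- r | P i) H i ^+ 2).
Proof.
set a := \sum_(i <- r | P i) F i ^+ 2; set b := \sum_(i <- r | P i) F i * H i.
set c := \sum_(i <- r | P i) H i ^+ 2.
have key t : 0 <= t ^+ 2 * a - 2 * t * b + c.
  suff -> : t ^+ 2 * a - 2 * t * b + c = \sum_(i <- r | P i) (t * F i - H i) ^+ 2.
    by apply: sumr_ge0 => i _; apply: sqr_ge0.
  rewrite /a /b /c !mulr_sumr -sumrB -big_split /=.
  by apply: eq_bigr => i _; ring.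
have a0 : 0 <= a by apply: sumr_ge0 => i _; apply: sqr_ge0.
have [az|an] := eqVneq a 0.
  have := key ((c + 1) / (2 * b)); rewrite az mulr0 add0r mul0r.
  have [->|bn] := eqVneq b 0; first by rewrite expr0n.
  have -> : 2 * ((c + 1) / (2 * b)) * b = c + 1 by field.
  by move=> ?; lra.
have := key (b / a).
have -> : (b / a) ^+ 2 * a - 2 * (b / a) * b + c = (a * c - b ^+ 2) / a by field.
have ap : 0 < a by rewrite lt_neqAle eq_sym an.
by rewrite pmulr_lge0 ?invr_gt0 // subr_ge0.
Qed.

Lemma sqr_sum_le_size (I : Type) (r : seq I) (F : I -> R) :
  (\sum_(i <- r) F i) ^+ 2 <= (size r)%:R * \sum_(i <- r) F i ^+ 2.
Proof.
have := cauchy_schwarz r xpredT (fun=> 1) F.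
rewrite (eq_bigr F) => [|i _]; last by rewrite mul1r.
by rewrite big_const_seq count_predT iter_addr_0 expr1n.
Qed.

Lemma sum_by_label (I L : eqType) (r : seq I) (P : pred I) (lb : I -> L) (F : I -> R) :
  \sum_(i <- r | P i) F i =
  \sum_(l <- undup [seq lb i | i <- r & P i]) \sum_(i <- r | P i && (lb i == l)) F i.
Proof.
rewrite (exchange_big_dep P) /=; last by move=> l i _ /andP[].
rewrite big_seq_cond [RHS]big_seq_cond; apply: eq_bigr => i /andP[ir Pi].
rewrite big_mkcond (bigD1_seq (lb i)) /= ?undup_uniq ?Pi ?eqxx //=; last first.
  by rewrite mem_undup map_f // mem_filter Pi.
by rewrite big1 ?addr0 // => l; rewrite eq_sym => /negbTE ->.
Qed.

Lemma size_undup_map_code (I L : eqType) (Cd : finType) (r : seq I)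
    (lb : I -> L) (cd : I -> Cd) :
  {in r &, forall i j, cd i = cd j -> lb i = lb j} ->
  (size (undup (map lb r)) <= #|Cd|)%N.
Proof.
move=> H; have [f fE] : exists f : Cd -> option L,
    forall i, i \in r -> f (cd i) = Some (lb i).
  exists (fun c => omap lb (ohead [seq i <- r | cd i == c])) => i ir.
  case E: [seq j <- r | cd j == cd i] => [|j l] /=.
    by have : i \in [::] by rewrite -E mem_filter eqxx.
  have : j \in j :: l by rewrite inE eqxx.
  by rewrite -E mem_filter => /andP[/eqP cj jr]; congr Some; apply: H.
rewrite -(size_map (@Some L)) cardE -(size_map f).
apply: uniq_leq_size.
  by rewrite map_inj_uniq ?undup_uniq // => x y [].
move=> _ /mapP[l + ->]; rewrite mem_undup => /mapP[i ir ->].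
by apply/mapP; exists (cd i); rewrite ?mem_enum // fE.
Qed.

(** For fixed [x], the sum is split over at most [P1] labels, and Cauchy-Schwarz is
    applied to the sum over labels, then inside each label.  The sums of
    [F y ^+ 2] that arise depend on the label only, each [y] occurs in at most
    [P2] of them, and the sums of [H x y ^+ 2] are bounded by [B] for each
    label. *)
Lemma labelled_schur (I J L : eqType) (rI : seq I) (rJ : seq J)
    (ok : J -> I -> bool) (lb : J -> I -> L) (F : I -> R) (H : J -> I -> R)
    (P1 P2 : nat) (B : R) : 0 <= B ->
  (forall x, x \in rJ -> (size (undup [seq lb x y | y <- rI & ok x y]) <= P1)%N) ->
  (forall y, y \in rI -> (size (undup [seq lb x y | x <- rJ & ok x y]) <= P2)%N) ->
  (forall l, \sum_(x <- rJ) \sum_(y <- rI | ok x y && (lb x y == l)) H x y ^+ 2 <= B) ->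
  \sum_(x <- rJ) (\sum_(y <- rI | ok x y) F y * H x y) ^+ 2 <=
  P1%:R * P2%:R * B * \sum_(y <- rI) F y ^+ 2.
Proof.
move=> B0 h1 h2 h3.
pose lbs := undup [seq lb x y | x <- rJ, y <- rI].
(* [FM l] runs over the [y] compatible with [l] for at least one [x], in order not
   to depend on [x]. *)
pose FM l := \sum_(y <- rI | has (fun x => ok x y && (lb x y == l)) rJ) F y ^+ 2.
pose HM x l := \sum_(y <- rI | ok x y && (lb x y == l)) H x y ^+ 2.
have FM0 l : 0 <= FM l by apply: sumr_ge0 => i _; apply: sqr_ge0.
have HM0 x l : 0 <= HM x l by apply: sumr_ge0 => i _; apply: sqr_ge0.
have step1 x : x \in rJ -> (\sum_(y <- rI | ok x y) F y * H x y) ^+ 2 <=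
    P1%:R * \sum_(l <- lbs) FM l * HM x l.
  move=> xJ; rewrite (sum_by_label _ _ (lb x)).
  apply: (le_trans (sqr_sum_le_size _ _)); apply: ler_pM => //.
  - by apply: sumr_ge0 => l _; apply: sqr_ge0.
  - by rewrite ler_nat h1.
  have sub : {subset undup [seq lb x y | y <- rI & ok x y] <= lbs}.
    move=> l; rewrite !mem_undup => /mapP[y]; rewrite mem_filter => /andP[_ yI] ->.
    exact: allpairs_f.
  rewrite [leRHS](bigID (mem (undup [seq lb x y | y <- rI & ok x y]))) /=.
  apply: ler_wpDr; first by apply: sumr_ge0 => l _; apply: mulr_ge0.
  rewrite -[leRHS]big_filter.
  rewrite [leRHS](perm_big (undup [seq lb x y | y <- rI & ok x y])); last first.
    apply: uniq_perm; rewrite ?filter_uniq ?undup_uniq // => l.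
    by rewrite mem_filter; case: (boolP (l \in undup _)) => // /sub ->.
  apply: ler_sum => l _; apply: (le_trans (cauchy_schwarz _ _ _ _)).
  apply: ler_wpM2r; first exact: HM0.
  rewrite /FM.
  rewrite [leRHS](bigID (fun y => ok x y && (lb x y == l))) /=.
  apply: ler_wpDr; first by apply: sumr_ge0 => y _; apply: sqr_ge0.
  rewrite le_eqVlt; apply/orP; left; apply/eqP. apply: eq_bigl => y.
  case: (boolP (_ && _)) => h; rewrite ?andbF // andbT.
  by apply/esym/hasP; exists x.
have step2 : \sum_(x <- rJ) (\sum_(y <- rI | ok x y) F y * H x y) ^+ 2 <=
    P1%:R * \sum_(l <- lbs) FM l * B.
  apply: (@le_trans _ _ (\sum_(x <- rJ) P1%:R * \sum_(l <- lbs) FM l * HM x l)).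
    by rewrite big_seq [leRHS]big_seq; apply: ler_sum => x; apply: step1.
  rewrite -mulr_sumr ler_wpM2l // exchange_big /=; apply: ler_sum => l _.
  by rewrite -mulr_sumr ler_wpM2l // h3.
have step3 : \sum_(l <- lbs) FM l <= P2%:R * \sum_(y <- rI) F y ^+ 2.
  rewrite /FM (exchange_big_dep xpredT) //= mulr_sumr big_seq [leRHS]big_seq.
  apply: ler_sum => y yI; rewrite -big_filter big_const_seq count_predT iter_addr_0.
  rewrite -[leLHS]mulr_natl; apply: ler_wpM2r; first exact: sqr_ge0.
  rewrite ler_nat (leq_trans _ (h2 y yI)) //; apply: uniq_leq_size.
    by rewrite filter_uniq ?undup_uniq.
  move=> l; rewrite mem_filter mem_undup => /andP[/hasP[x xJ /andP[okx /eqP <-]] _].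
  by rewrite map_f // mem_filter okx.
apply: (le_trans step2); rewrite -mulr_suml.
have -> : P1%:R * P2%:R * B * (\sum_(y <- rI) F y ^+ 2) =
  P1%:R * (P2%:R * (\sum_(y <- rI) F y ^+ 2) * B) by ring.
by rewrite ler_wpM2l // ler_wpM2r.
Qed.

End Schur.

(** * The convolution estimate for finite sums *)

Section FiniteBound.
Context (R : realFieldType) (G : groupType) (len : G -> nat) (L : eqType)
    (med : G -> G -> L) (Q : finType).
Hypothesis MC : median_coding len med Q.
Hypothesis lenV : forall g, len g^-1%g = len g.
Context (n : nat) (F H : G -> R) (a b : R).
Hypothesis Hn : forall w, H w != 0 -> (len w <= n)%N.
Hypothesis Fa : forall r : seq G, uniq r -> \sum_(y <- r) F y ^+ 2 <= a.
Hypothesis Hb : forall r : seq G, uniq r -> \sum_(w <- r) H w ^+ 2 <= b.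

Let P := #|{: {ffun Q -> 'I_n.+1}}|.

(** Pairs are grouped by the quotient [w = y^-1 * x]; given [w] and the label, [y]
    is determined by its code. *)
Lemma fibre_bound (rI rJ : seq G) l : uniq rI -> uniq rJ ->
  \sum_(x <- rJ) \sum_(y <- rI | (len (y^-1 * x)%g <= n)%N && (med x y == l))
     H (y^-1 * x)%g ^+ 2 <= (P * #|Q|)%:R * b.
Proof.
move=> uI uJ; have [medC _ [c cP]] := MC n.
pose pairs := [seq (x, y) | x <- rJ, y <- rI].
have uP : uniq pairs by apply: allpairs_uniq => // -[? ?] [? ?].
pose okl (p : G * G) := (len (p.2^-1 * p.1)%g <= n)%N && (med p.1 p.2 == l).
pose quo (p : G * G) := (p.2^-1 * p.1)%g.
have -> : \sum_(x <- rJ) \sum_(y <- rI | (len (y^-1 * x)%g <= n)%N && (med x y == l))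
     H (y^-1 * x)%g ^+ 2 = \sum_(p <- pairs | okl p) H (quo p) ^+ 2.
  rewrite [RHS]big_mkcond big_allpairs /=; apply: eq_bigr => x _.
  by rewrite [LHS]big_mkcond.
rewrite (sum_by_label _ _ quo); set W := undup _.
apply: (@le_trans _ _ (\sum_(w <- W) (P * #|Q|)%:R * H w ^+ 2)); last first.
  by rewrite -mulr_sumr ler_wpM2l // Hb // undup_uniq.
apply: ler_sum => w _.
rewrite (eq_bigr (fun=> H w ^+ 2)); last by move=> p /andP[_ /eqP ->].
rewrite -big_filter big_const_seq count_predT iter_addr_0 -[leLHS]mulr_natl.
rewrite ler_wpM2r ?sqr_ge0 // ler_nat -card_prod cardE.
rewrite -(size_map (fun p : G * G => c w p.2)).
apply: uniq_leq_size => [|d _]; last by rewrite mem_enum.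
rewrite map_inj_in_uniq ?filter_uniq // => -[x y] [x' y'].
rewrite !mem_filter /okl /quo /= => /andP[/andP[/andP[yw /eqP Ml] /eqP xw] _].
move=> /andP[/andP[/andP[_ /eqP Ml'] /eqP xw'] _] E.
have xE : x = (y * w)%g by rewrite -xw mulVKg.
have xE' : x' = (y' * w)%g by rewrite -xw' mulVKg.
have yy : y = y'.
  apply: (cP w) => //; first by rewrite -xw.
  by rewrite medC -xE Ml -Ml' medC xE'.
by rewrite xE xE' yy.
Qed.

Lemma finite_convolution_bound (rI rJ : seq G) : uniq rI -> uniq rJ ->
  \sum_(x <- rJ) (\sum_(y <- rI) F y * H (y^-1 * x)%g) ^+ 2 <=
  (#|Q| * n.+1 ^ (3 * #|Q|))%:R * a * b.
Proof.
move=> uI uJ; have [medC [c cP] _] := MC n.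
have a0 : 0 <= a by have := Fa (r := [::]) isT; rewrite big_nil.
have b0 : 0 <= b by have := Hb (r := [::]) isT; rewrite big_nil.
have PE : P = (n.+1 ^ #|Q|)%N by rewrite /P card_ffun card_ord.
pose ok x y := (len (y^-1 * x)%g <= n)%N.
have okV x y : ok x y -> (len (x^-1 * y)%g <= n)%N.
  by rewrite /ok -lenV invgM invgK.
have -> : \sum_(x <- rJ) (\sum_(y <- rI) F y * H (y^-1 * x)%g) ^+ 2 =
    \sum_(x <- rJ) (\sum_(y <- rI | ok x y) F y * H (y^-1 * x)%g) ^+ 2.
  apply: eq_bigr => x _; congr (_ ^+ 2); rewrite [RHS]big_mkcond.
  apply: eq_bigr => y _; case: ifP => // okxy.
  have [->|/Hn] := eqVneq (H (y^-1 * x)%g) 0; first by rewrite mulr0.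
  by rewrite -/(ok x y) okxy.
have := @labelled_schur R G G L rI rJ ok med F (fun x y => H (y^-1 * x)%g)
  P P ((P * #|Q|)%:R * b).
have B0 : 0 <= (P * #|Q|)%:R * b by rewrite mulr_ge0.
have h1 x : x \in rJ -> (size (undup [seq med x y | y <- rI & ok x y]) <= P)%N.
  move=> _; apply: (size_undup_map_code (cd := c x)) => y z.
  by rewrite !mem_filter => /andP[/okV yx _] /andP[/okV zx _]; apply: cP.
have h2 y : y \in rI -> (size (undup [seq med x y | x <- rJ & ok x y]) <= P)%N.
  move=> _; apply: (size_undup_map_code (cd := c y)) => x z.
  rewrite !mem_filter => /andP[yx _] /andP[yz _] E.
  by rewrite medC [RHS]medC; apply: cP.
move=> /(_ B0 h1 h2 (fun l => fibre_bound l uI uJ)) /le_trans; apply.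
apply: (@le_trans _ _ (P%:R * P%:R * ((P * #|Q|)%:R * b) * a)).
  by rewrite ler_wpM2l ?Fa // !mulr_ge0.
rewrite le_eqVlt; apply/orP; left; apply/eqP.
by rewrite PE mulnC expnM (expnAC _ 3) !expnS expn0 !natrM; ring.
Qed.
End FiniteBound.

(** * Passage to unordered sums *)

Section Esum.
Context (R : realType) (T : choiceType).

Lemma esum_le_fin (a : T -> R) (c : R) :
  (forall r : seq T, uniq r -> \sum_(x <- r) a x <= c) ->
  (\esum_(x in [set: T]) (a x)%:E <= c%:E)%E.
Proof.
move=> H; apply: ge_ereal_sup => _ [A [finA _] <-].
by rewrite fsbig_finite // sumEFin lee_fin H // fset_uniq.
Qed.

Lemma sum_le_esum (a : T -> R) (r : seq T) : uniq r ->
  ((\sum_(x <- r) a x)%:E <= \esum_(x in [set: T]) (a x)%:E)%E.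
Proof.
move=> ur; apply: ereal_sup_ubound; exists [set` r].
  by split => //; apply: finite_seq.
by rewrite -fsbig_seq // sumEFin.
Qed.

Lemma esum_lt_sum (a : T -> R) (c : R) :
  (c%:E < \esum_(x in [set: T]) (a x)%:E)%E ->
  exists2 r : seq T, uniq r & c < \sum_(x <- r) a x.
Proof.
move=> /ereal_sup_gt[_ [A [finA _] <-]]; rewrite fsbig_finite // sumEFin lte_fin.
by move=> h; exists (enum_fset (fset_set A)); rewrite ?fset_uniq.
Qed.

Lemma fine_esum_ge0 (a : T -> R) : (forall x, 0 <= a x) ->
  0 <= fine (\esum_(x in [set: T]) (a x)%:E).
Proof. by move=> a0; apply: fine_ge0; apply: esum_ge0 => x _; rewrite lee_fin. Qed.

(** The positive and the negative parts of the family have sums between 0 and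
    [c], so their difference does not exceed [c] in absolute value. *)
Lemma real_sum_le (a b : T -> R) (c : R) : (forall x, `|a x| <= b x) ->
  (\esum_(x in [set: T]) (b x)%:E <= c%:E)%E -> `|real_sum a| <= c.
Proof.
move=> ab bc; rewrite /real_sum.
have half (d : T -> R) : (forall x, 0 <= d x <= b x) ->
    0 <= fine (\esum_(x in [set: T]) (d x)%:E) <= c.
  move=> db; rewrite fine_esum_ge0 /=; last by move=> x; case/andP: (db x).
  have le : (\esum_(x in [set: T]) (d x)%:E <= c%:E)%E.
    apply: le_trans bc; apply: le_esum => x _; rewrite lee_fin.
    by case/andP: (db x).
  have ge : (0 <= \esum_(x in [set: T]) (d x)%:E)%E.
    by apply: esum_ge0 => x _; rewrite lee_fin; case/andP: (db x).
  by move: le ge; case: (esum _ _) => [r||] //; rewrite ?leye_eq // !lee_fin.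
have /andP[p0 pc] : 0 <= fine (\esum_(x in [set: T]) (Num.max (a x) 0)%:E) <= c.
  apply: half => x; rewrite le_max lexx orbT /= ge_max.
  by rewrite (le_trans (ler_norm _) (ab x)) (le_trans _ (ab x)).
have /andP[q0 qc] : 0 <= fine (\esum_(x in [set: T]) (Num.max (- a x) 0)%:E) <= c.
  apply: half => x; rewrite le_max lexx orbT /= ge_max (le_trans _ (ab x)) //=.
    by rewrite (le_trans _ (ab x)).
  by rewrite -normrN ler_norm.
by rewrite ler_norml; apply/andP; split; lra.
Qed.

End Esum.

Lemma sqr_normc (R : rcfType) (z : R[i]) :
  Normc.normc z ^+ 2 = complex.Re z ^+ 2 + complex.Im z ^+ 2.
Proof. by case: z => u v /=; rewrite sqr_sqrtr // addr_ge0 ?sqr_ge0. Qed.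

Lemma normr_Re_le (R : rcfType) (z : R[i]) : `|complex.Re z| <= Normc.normc z.
Proof.
by case: z => u v /=; rewrite -sqrtr_sqr ler_wsqrtr // lerDl sqr_ge0.
Qed.

Lemma normr_Im_le (R : rcfType) (z : R[i]) : `|complex.Im z| <= Normc.normc z.
Proof.
by case: z => u v /=; rewrite -sqrtr_sqr ler_wsqrtr // lerDr sqr_ge0.
Qed.

Lemma normc_ge0 (R : rcfType) (z : R[i]) : 0 <= Normc.normc z.
Proof. by case: z => u v; apply: sqrtr_ge0. Qed.

(** The factor 2 comes from estimating real and imaginary parts separately. *)
Lemma sqr_normc_complex_sum (R : realType) (T : choiceType) (a : T -> R[i]) (c : R) :
  (\esum_(x in [set: T]) (Normc.normc (a x))%:E <= c%:E)%E ->
  Normc.normc (complex_sum a) ^+ 2 <= 2 * c ^+ 2.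
Proof.
move=> ac; rewrite sqr_normc /=.
have hr := real_sum_le (fun x => normr_Re_le (a x)) ac.
have hi := real_sum_le (fun x => normr_Im_le (a x)) ac.
have c0 : 0 <= c := le_trans (normr_ge0 _) hr.
have -> : 2 * c ^+ 2 = c ^+ 2 + c ^+ 2 by ring.
apply: lerD; rewrite -real_normK ?num_real //; rewrite ler_pXn2r // nnegrE //.
Qed.

Section Limit.
Context (R : realType) (T : choiceType).

(** Finitely many of the suprema [c x] can be approximated simultaneously, up to a
    factor [t < 1], by sums over a common finite set; then [t] tends to 1. *)
Lemma sup_sqr_sum_le (J : eqType) (rJ : seq J) (g : J -> T -> R) (d : R) :
  (forall x y, 0 <= g x y) ->
  (forall rI, uniq rI -> \sum_(x <- rJ) (\sum_(y <- rI) g x y) ^+ 2 <= d) ->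
  exists2 c : J -> R,
    forall x, x \in rJ -> (\esum_(y in [set: T]) (g x y)%:E <= (c x)%:E)%E &
    \sum_(x <- rJ) c x ^+ 2 <= d.
Proof.
move=> g0 H.
have d0 : 0 <= d.
  by apply: le_trans (H [::] isT); apply: sumr_ge0 => x _; apply: sqr_ge0.
pose E x := (\esum_(y in [set: T]) (g x y)%:E)%E.
have E0 x : (0 <= E x)%E by apply: esum_ge0 => y _; rewrite lee_fin.
have Efin x : x \in rJ -> E x = (fine (E x))%:E.
  move=> xJ; suff : (E x <= (1 + d)%:E)%E.
    by move: (E0 x); case: (E x) => //=; rewrite ?leye_eq.
  apply: esum_le_fin => r ur; set u := \sum_(y <- r) _.
  have : u ^+ 2 <= d.
    apply: le_trans (H r ur); rewrite (big_rem x) //= lerDl.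
    by apply: sumr_ge0 => z _; apply: sqr_ge0.
  have : 0 <= u by apply: sumr_ge0.
  by move=> u0 ud; nra.
pose c x := fine (E x).
have c0 x : 0 <= c x by apply: fine_ge0.
exists c => [x xJ|]; first by rewrite -Efin.
have scaled t : 0 < t -> t < 1 -> t ^+ 2 * \sum_(x <- rJ) c x ^+ 2 <= d.
  move=> t0 t1.
  have approx x : exists r : seq T, x \in rJ -> uniq r /\ t * c x <= \sum_(y <- r) g x y.
    case: (boolP (x \in rJ)) => xJ; last by exists [::].
    have [c00|cn0] := eqVneq (c x) 0.
      by exists [::]; rewrite c00 mulr0 big_nil.
    have cp : 0 < c x by rewrite lt_neqAle eq_sym cn0 c0.
    have [|r ur rc] := @esum_lt_sum _ _ (g x) (t * c x).
      by rewrite -/(E x) Efin // lte_fin -/(c x) gtr_pMl.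
    by exists r => _; split=> //; apply: ltW.
  have [r rP] := choice approx.
  pose rI := undup (flatten [seq r x | x <- rJ]).
  apply: le_trans (H rI (undup_uniq _)); rewrite mulr_sumr big_seq [leRHS]big_seq.
  apply: ler_sum => x xJ; rewrite -exprMn ler_pXn2r ?nnegrE //; last 2 first.
  - by rewrite mulr_ge0 // ltW.
  - exact: sumr_ge0.
  have [ur rx] := rP x xJ; apply: (le_trans rx).
  rewrite [leRHS](bigID (mem (r x))) /=; apply: ler_wpDr; first exact: sumr_ge0.
  rewrite -[leRHS]big_filter (perm_big [seq y <- rI | y \in r x]) //.
  apply: uniq_perm; rewrite ?filter_uniq ?undup_uniq // => y.
  rewrite mem_filter mem_undup; case: (boolP (y \in r x)) => //= yr.
  by apply/esym/flattenP; exists (r x) => //; apply: map_f.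
set S := \sum_(x <- rJ) c x ^+ 2 in scaled *.
rewrite leNgt; apply/negP => dS.
have Sp : 0 < S := le_lt_trans d0 dS.
have q1 : d / S < 1 by rewrite ltr_pdivrMr // mul1r.
have q0 : 0 <= d / S by rewrite divr_ge0 // ltW.
have : ((1 + d / S) / 2) ^+ 2 <= d / S.
  by rewrite ler_pdivlMr //; apply: scaled; lra.
nra.
Qed.
End Limit.

Theorem median_coding_rapid_decay (R : realType) (G : groupType) (len : G -> nat)
    (L : eqType) (med : G -> G -> L) (Q : finType) (n : nat) (h f : G -> R[i]) :
  median_coding len med Q -> (forall g, len g^-1%g = len g) ->
  l2 h -> (forall x, h x <> 0 -> (len x <= n)%N) -> l2 f ->
  (l2norm (convolution f h) <=
   (Num.sqrt (2 * #|Q|.+1%:R) * (n%:R + 1) `^ (3 / 2 * #|Q|%:R))%:E *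
     l2norm f * l2norm h)%E.
Proof.
move=> MC lenV h2 hn f2.
pose F y := Normc.normc (f y); pose H w := Normc.normc (h w).
have l2fin (k : G -> R[i]) : l2 k -> exists2 a : R, 0 <= a &
    (\esum_(x in [set: G]) (Normc.normc (k x) ^+ 2)%:E)%E = a%:E.
  rewrite /l2 /l2norm /=.
  have : (0 <= \esum_(x in [set: G]) (Normc.normc (k x) ^+ 2)%:E)%E.
    by apply: esum_ge0 => x _; rewrite lee_fin sqr_ge0.
  by case: (esum _ _) => [r||] //= r0 _; exists r; rewrite -?lee_fin.
have [a a0 aE] := l2fin f f2; have [b b0 bE] := l2fin h h2.
have Fa r : uniq r -> \sum_(y <- r) F y ^+ 2 <= a.
  by move=> ur; rewrite -lee_fin -aE; apply: (@sum_le_esum _ _ (fun y => F y ^+ 2)).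
have Hb r : uniq r -> \sum_(y <- r) H y ^+ 2 <= b.
  by move=> ur; rewrite -lee_fin -bE; apply: (@sum_le_esum _ _ (fun y => H y ^+ 2)).
have Hn w : H w != 0 -> (len w <= n)%N.
  move=> Hw; apply: hn => hw; move: Hw; rewrite /H hw.
  by rewrite Normc.normc0 eqxx.
pose k : R := (#|Q| * n.+1 ^ (3 * #|Q|))%:R * a * b.
have fin rI rJ := finite_convolution_bound MC lenV Hn Fa Hb (rI := rI) (rJ := rJ).
have conv_le : (\esum_(x in [set: G]) (Normc.normc (convolution f h x) ^+ 2)%:E
    <= (2 * k)%:E)%E.
  apply: (@esum_le_fin _ _ (fun x => Normc.normc (convolution f h x) ^+ 2)) => rJ uJ.
  have [||c cP ck] := @sup_sqr_sum_le R G G rJ (fun x y => F y * H (y^-1 * x)%g) k.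
  - by move=> x y; rewrite mulr_ge0 // normc_ge0.
  - by move=> rI uI; apply: fin.
  apply: (@le_trans _ _ (\sum_(x <- rJ) 2 * c x ^+ 2)); last first.
    by rewrite -mulr_sumr ler_pM2l.
  rewrite big_seq [leRHS]big_seq; apply: ler_sum => x xJ.
  apply: sqr_normc_complex_sum; apply: le_trans (cP x xJ).
  by apply: le_esum => y _; rewrite Normc.normcM.
rewrite /l2norm aE bE.
apply: (@le_trans _ _ (sqrte (2 * k)%:E)).
  rewrite lee_sqrt // lee_fin /k; rewrite !mulr_ge0 //.
rewrite /= -!EFinM lee_fin /k.
have p0 : 0 <= (n%:R + 1 : R) by rewrite addr_ge0.
have e0 : 0 <= (n%:R + 1 : R) `^ (3 / 2 * #|Q|%:R) by apply: powR_ge0.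
(* The product of the three counts is a perfect square for the real exponent. *)
have E : ((n%:R + 1 : R) `^ (3 / 2 * #|Q|%:R)) ^+ 2 = (n.+1 ^ (3 * #|Q|))%:R.
  rewrite -powR_mulrn // -powRrM natrX -(natr1 n) -powR_mulrn //; congr (_ `^ _).
  by rewrite natrM; field.
rewrite -[X in _ <= _ * X * _ * _](ger0_norm e0) -sqrtr_sqr E -!sqrtrM; last 3 first.
- by rewrite !mulr_ge0.
- by rewrite !mulr_ge0.
- by rewrite mulr_ge0.
apply: ler_wsqrtr; rewrite natrM -!mulrA ler_pM2l // ler_wpM2r ?mulr_ge0 //.
by rewrite ler_nat.
Qed.

(** * From the presentation to the representation *)

Section Presentation.
Context (G : groupType) (A : Type) (i : A -> G) (m : A -> A -> nat).
Hypothesis m_diag : forall a, m a a = 1%N.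
Hypothesis pres : has_presentation i (coxeter_relators m).

Lemma eval_word_cat v w : eval_word i (v ++ w) = (eval_word i v * eval_word i w)%g.
Proof. exact: big_cat. Qed.

Lemma presented_rel a b : ((i a * i b) ^+ m a b = 1)%g.
Proof.
pose r := flatten (nseq (m a b) [:: (a, true); (b, true)]).
have : presented_eq (coxeter_relators m) r [::].
  by rewrite -[r]cats0; apply: (presented_relator [::] [::]); exists a, b.
move=> /(pres.2 _ _).2; rewrite {2}/eval_word big_nil => <-.
rewrite /r; elim: (m a b) => [|k IH]; first by rewrite /eval_word big_nil expg0.
by rewrite expgS IH -[RHS]/(eval_word i ([:: _; _] ++ _)) eval_word_cat
  {2}/eval_word !big_cons big_nil mulg1.
Qed.

Lemma presented_sq a : (i a * i a = 1)%g.
Proof. by have := presented_rel a a; rewrite m_diag expg1. Qed.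

Lemma presented_gen g : exists w : seq A, g = (\prod_(a <- w) i a)%g.
Proof.
have [w <-] := pres.1 g; exists [seq a.1 | a <- w].
rewrite /eval_word big_map; apply: eq_bigr => -[a []] //= _.
exact/mulg1_eq/presented_sq.
Qed.

(** Images are computed on words, disregarding the exponents of the letters, since
    the diagonal relations make all generators involutions. *)
Lemma presented_morphism (T : pzRingType) (f : A -> T) :
  (forall a b, (f a * f b) ^+ m a b = 1) ->
  exists rho : G -> T, [/\ rho 1%g = 1, forall g h, rho (g * h)%g = rho g * rho h &
    forall a, rho (i a) = f a].
Proof.
move=> frel; pose fw (w : fword A) := \prod_(a <- w) f a.1.
have fw_cat v w : fw (v ++ w) = fw v * fw w by exact: big_cat.
have fw_eq v w : presented_eq (coxeter_relators m) v w -> fw v = fw w.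
  elim=> [//|v' w' _ ->//|u v' w' _ -> _ ->//|u v' a b|u v' r [a [b ->]]].
    rewrite !fw_cat; congr (_ * _); rewrite /fw big_cons big_cons /= big_nil mulr1.
    by have := frel a a; rewrite m_diag expr1 => ->; rewrite mul1r.
  rewrite !fw_cat -[in RHS](mul1r (fw v')); congr (_ * (_ * _)).
  rewrite -[RHS](frel a b); elim: (m a b) => [|k IH]; first by rewrite /fw big_nil.
  by rewrite exprS -IH -[LHS]/(fw ([:: _; _] ++ _)) fw_cat {1}/fw !big_cons big_nil
    mulr1.
have [c cE] := choice pres.1.
pose rho g := fw (c g).
have rho_eval w : rho (eval_word i w) = fw w.
  by apply: fw_eq; apply/(pres.2 _ _).1; rewrite cE.
exists rho; split.
- by have := rho_eval [::]; rewrite /eval_word /fw !big_nil.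
- by move=> g h; rewrite -[in LHS](cE g) -[in LHS](cE h) -eval_word_cat rho_eval fw_cat.
move=> a; have := rho_eval [:: (a, true)].
by rewrite /eval_word /fw !big_cons !big_nil /= mulg1 mulr1.
Qed.
End Presentation.

Theorem coxeter_system_rep (R : realType) (G : groupType) (S : set G) :
  coxeter_system S -> finite_set S ->
  exists n (m : 'I_n -> 'I_n -> nat) (s : 'I_n -> G) (rho : G -> 'M[R]_n) (sgn : G -> R),
    coxeter_rep m s rho sgn /\ (forall x, S x -> exists i, s i = x).
Proof.
move=> [m [[m_sym m_diag m_off] pres]] /finite_seqP[l0 Sl0].
pose l := undup l0.
have lS (i : 'I_(size l)) : tnth (in_tuple l) i \in S.
  by apply/mem_set; rewrite Sl0 /= -mem_undup mem_tnth.
pose e (i : 'I_(size l)) : S := exist (fun x => x \in S) _ (lS i).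
have eE i : val (e i) = tnth (in_tuple l) i by [].
have Sl (x : S) : val x \in l.
  by rewrite mem_undup; have := set_valP x; rewrite {1}Sl0.
have ix (x : S) : (index (val x) l < size l)%N by rewrite index_mem.
pose d (x : S) : 'I_(size l) := Ordinal (ix x).
have ed x : e (d x) = x.
  by apply: val_inj; rewrite eE (tnth_nth (val x)) /= nth_index // Sl.
have e_inj : injective e.
  move=> i j /(congr1 val); rewrite !eE => h; apply/val_inj => /=.
  move: h; rewrite !(tnth_nth 1%g) /=.
  by move=> /eqP; rewrite nth_uniq ?undup_uniq // => /eqP.
pose m' i j := m (e i) (e j).
have sym' i j : m' i j = m' j i by apply: m_sym.
have diag' i : m' i i = 1%N by apply: m_diag.
have off' i j : i <> j -> m' i j <> 1%N by move=> ij; apply: m_off => /e_inj.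
have mE x y : m x y = m' (d x) (d y) by rewrite /m' !ed.
have [rho [rho1 rhoM rhos]] : exists rho : G -> 'M[R]_(size l),
    [/\ rho 1%g = 1, forall g h, rho (g * h)%g = rho g * rho h &
      forall x : S, rho (val x) = reflection m' (simple_root R (d x))].
  apply: (presented_morphism m_diag pres) => x y.
  by rewrite mE; apply: coxeter_relation.
have [sgn [sgn1 sgnM sgns]] : exists sgn : G -> R,
    [/\ sgn 1%g = 1, forall g h, sgn (g * h)%g = sgn g * sgn h &
      forall x : S, sgn (val x) = -1].
  by apply: (presented_morphism m_diag pres) => x y; rewrite mulrNN mulr1 expr1n.
exists (size l), m', (fun i => val (e i)), rho, sgn; split; last first.
  move=> x Sx; exists (d (exist (fun x => x \in S) _ (mem_set Sx))).
  by rewrite ed.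
have de i : d (e i) = i by apply: e_inj; rewrite ed.
split=> //.
- move=> g; have [w ->] := presented_gen m_diag pres g.
  by exists (map d w); rewrite big_map; apply: eq_bigr => x _; rewrite ed.
- by move=> i j; apply: (presented_rel pres).
- by move=> i; rewrite rhos de.
Qed.

Theorem corollary1 (R : realType) (G : groupType) (S : set G)
    (HS : coxeter_system S) (Sfin : finite_set S) :
  exists (C : R) (Lambda : nat), 0 < C /\
    forall (n : nat) (h f : G -> R[i]),
      l2 h -> (forall x, h x <> 0 -> has_length S x n) -> l2 f ->
      (l2norm (convolution f h) <=
       (C * (n%:R + 1) `^ (3 / 2 * Lambda%:R))%:E * l2norm f * l2norm h)%E.
Proof.
have [n0 [m [s [rho [sgn [CR sS]]]]]] := coxeter_system_rep R HS Sfin.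
have [L [med [Q MC]]] := median_codes CR.
exists (Num.sqrt (2 * #|Q|.+1%:R)), #|Q|; split.
  by rewrite sqrtr_gt0 mulr_gt0.
move=> n h f h2 hn f2.
apply: (median_coding_rapid_decay MC) => //; first exact: lenV (gen_sq CR).
move=> x /hn[[w [<- wS <-]] _] {h hn h2}.
have [v ->] : exists v, w = map s v.
  elim: w wS => [|a w IH] wS; first by exists [::].
  have [|v ->] := IH; first by move=> b bw; apply: wS; rewrite inE bw orbT.
  by have [i <-] := sS a (wS a (mem_head _ _)); exists (i :: v).
by rewrite big_map size_map; apply: len_min.
Qed.
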